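(* For every fixed integer $r \ge 5$, as $n \to \infty$, \[ \mathrm{ex}(n, K_{r,r}) = \Omega\Big(n^{2-2/(r+1)}\,(\ln\ln n)^{1/(r^2-1)}\Big). \]
   Context: $\mathrm{ex}(n,H)$ denotes the largest integer $m$ such that there exists a graph on $n$ vertices with $m$ edges containing no (not necessarily induced) subgraph isomorphic to $H$. $K_{r,r}$ is the complete bipartite graph with both parts of size $r$. The implied constant may depend on $r$. *)

(* Defs.v *)
From mathcomp Require Import all_boot.
Set Implicit Arguments. Unset Strict Implicit. Unset Printing Implicit Defensive.

(* A simple graph on vertex set 'I_n is encoded by its edge set D,
   each edge {x,y} stored once as the ordered pair (x,y) with x < y. *)
Definition simple_graph (n : nat) (D : {set 'I_n * 'I_n}) : bool :=
  [forall p in D, (p.1 < p.2)%N].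

Definition adj (n : nat) (D : {set 'I_n * 'I_n}) (x y : 'I_n) : bool :=
  ((x, y) \in D) || ((y, x) \in D).

Definition contains_Krr (n : nat) (D : {set 'I_n * 'I_n}) (r : nat) : bool :=
  [exists A : {set 'I_n}, exists B : {set 'I_n},
    [&& #|A| == r, #|B| == r, [disjoint A & B] &
        [forall a in A, forall b in B, adj D a b]]].

Definition ex_Krr (n r : nat) : nat :=
  \max_(D : {set 'I_n * 'I_n} | simple_graph D && ~~ contains_Krr D r) #|D|.

(* Main.v *)
(** Let k = r^2 and consider the k-uniform hypergraph whose vertices are the pairs of
    points of [n] and whose hyperedges are the edge sets of the copies of K_{r,r}; a
    K_{r,r}-free graph is an independent set.

    Keep each pair with probability p, where p^(k-1) n^(2r-2) is of order D and D is a
    small power of ln n.  Two copies of K_{r,r} sharing more than one edge are so rare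
    that, after removing few pairs, the surviving hypergraph has maximum degree at most D
    and no cycles of length up to about D^3.

    Give each surviving pair a random label in {0, ..., M - 1} with M = D^3 and run the
    greedy algorithm by increasing label.  A label decreases along each dependency, so
    the decision at a pair depends on a neighbourhood of radius M, which is a tree; there
    the events at different branches are independent.  If b_i is the probability that a
    pair other than the root is accepted with label less than i, then
    b_{i+1} = b_i + (1/M) (1 - b_i^(k-1))^(D-1), which forces b_M^(k-1) to be at least of
    order (ln D) / D.  Thus a proportion ((ln D) / D)^(1/(k-1)) of the surviving pairs is
    accepted, and ln D is of order ln ln n. *)

Require Import Defs.
From Stdlib Require Import Reals.
From mathcomp Require all_boot all_order all_algebra zify lra Rstruct.

Module SparseHypergraphs.

Import all_boot all_order all_algebra zify lra Rstruct.
Import Order.TTheory GRing.Theory Num.Theory.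
Set Implicit Arguments. Unset Strict Implicit. Unset Printing Implicit Defensive.

(** * Expectation over product measures *)

Local Open Scope ring_scope.

Section Expectation.
Variables (F : realFieldType) (V S : finType) (w : V -> S -> F).

Definition weight (s : {ffun V -> S}) : F := \prod_v w v (s v).
Definition expect (f : {ffun V -> S} -> F) : F := \sum_s weight s * f s.
Definition depends_on (A : {set V}) (f : {ffun V -> S} -> F) :=
  forall s s' : {ffun V -> S}, {in A, s =1 s'} -> f s = f s'.

Lemma eq_expect f g : f =1 g -> expect f = expect g.
Proof. by move=> fg; apply: eq_bigr => s _; rewrite fg. Qed.

Lemma expectB f g : expect (fun s => f s - g s) = expect f - expect g.
Proof.
by rewrite /expect -sumrB; apply: eq_bigr => s _; rewrite mulrBr.
Qed.

Lemma expectZ c f : expect (fun s => c * f s) = c * expect f.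
Proof.
by rewrite /expect mulr_sumr; apply: eq_bigr => s _; rewrite mulrCA.
Qed.

Lemma expect_sum (I : Type) (r : seq I) (P : pred I) f :
  expect (fun s => \sum_(i <- r | P i) f i s) = \sum_(i <- r | P i) expect (f i).
Proof.
by rewrite /expect exchange_big; apply: eq_bigr => s _; rewrite mulr_sumr.
Qed.

Lemma expect_prod_coord (g : V -> S -> F) :
  expect (fun s => \prod_v g v (s v)) = \prod_v \sum_a w v a * g v a.
Proof.
rewrite bigA_distr_bigA; apply: eq_bigr => s _.
by rewrite /weight -big_split.
Qed.

Hypothesis w_sum1 : forall v, \sum_a w v a = 1.

Lemma expect_cst c : expect (fun=> c) = c.
Proof.
rewrite /expect -mulr_suml /weight -(bigA_distr_bigA (fun v a => w v a)).
by rewrite big1 ?mul1r.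
Qed.

Lemma expect_coord v (g : S -> F) :
  expect (fun s => g (s v)) = \sum_a w v a * g a.
Proof.
pose G u a := if u == v then g a else 1.
have -> : expect (fun s => g (s v)) = expect (fun s => \prod_u G u (s u)).
  apply: eq_expect => s; rewrite (bigD1 v) //= big1 ?mulr1 /G ?eqxx //.
  by move=> u /negPf->.
rewrite expect_prod_coord (bigD1 v) //= [X in _ * X]big1 ?mulr1 /G ?eqxx // => u /negPf->.
by under eq_bigr do rewrite mulr1.
Qed.

(* Swapping the coordinates in A between two independent samples preserves
   the product weight; this turns E f * E g into E (f * g). *)
Lemma expect_indep (A B : {set V}) f g : [disjoint A & B] ->
  depends_on A f -> depends_on B g ->
  expect (fun s => f s * g s) = expect f * expect g.
Proof.
move=> dAB dA dB.
pose mix (s s' : {ffun V -> S}) := [ffun v => if v \in A then s v else s' v].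
pose sw (x : {ffun V -> S} * {ffun V -> S}) := (mix x.1 x.2, mix x.2 x.1).
have swK : involutive sw.
  case=> s s'; rewrite /sw /=.
  by congr (_, _); apply/ffunP => v; rewrite !ffunE; case: (v \in A).
have mulW s s' : weight (mix s s') * weight (mix s' s) = weight s * weight s'.
  rewrite /weight -!big_split; apply: eq_bigr => v _; rewrite !ffunE /=.
  by case: (v \in A); rewrite // mulrC.
have E1 : expect f * expect g = \sum_x (weight x.1 * weight x.2) * (f x.1 * g x.2).
  rewrite /expect big_distrlr pair_bigA; apply: eq_bigr => x _.
  by rewrite mulrACA.
have E2 : expect (fun s => f s * g s) =
    \sum_x (weight x.1 * weight x.2) * (f x.1 * g x.1).
  rewrite -[LHS]mulr1 -[in X in _ * X](expect_cst 1) /expect big_distrlr pair_bigA.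
  by apply: eq_bigr => x _ /=; rewrite mulr1 mulrAC.
rewrite E1 E2 (reindex_inj (inv_inj swK)); apply: eq_bigr => -[s s'] _ /=.
rewrite mulW; congr (_ * (_ * _)).
  by apply: dA => v vA; rewrite ffunE vA.
apply: dB => v vB; rewrite ffunE; case: ifP => // vA.
by have := disjointFr dAB vA; rewrite vB.
Qed.

(** Factors are peeled off one at a time: the remaining product depends only on the union of the
    remaining [A i], which is disjoint from the first. *)
Lemma expect_prod_indep (I : finType) (P : pred I) (A : I -> {set V}) f :
    (forall i, P i -> depends_on (A i) (f i)) ->
    (forall i j, P i -> P j -> i != j -> [disjoint A i & A j]) ->
  expect (fun s => \prod_(i | P i) f i s) = \prod_(i | P i) expect (f i).
Proof.
move=> dep dis; rewrite -(big_filter _ P).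
under eq_expect do rewrite -(big_filter _ P).
have: uniq [seq i <- index_enum I | P i] by rewrite filter_uniq ?index_enum_uniq.
have: all P [seq i <- index_enum I | P i] by apply: filter_all.
elim: [seq i <- index_enum I | P i] => [_ _|i l IHl /= /andP[Pi Pl] /andP[il ul]].
  by under eq_expect do rewrite big_nil; rewrite big_nil expect_cst.
under eq_expect do rewrite big_cons.
rewrite big_cons -IHl // (@expect_indep (A i) (\bigcup_(j <- l) A j)) //.
- rewrite bigcup_seq; apply/bigcup_disjointP => j jl.
  by apply: dis => //; [apply: (allP Pl) | apply: contraNneq il => ->].
- exact: dep.
- move=> s s' ss'; apply: eq_big_seq => j jl.
  apply: (dep j (allP Pl _ jl)) => v vA; apply: ss'.
  by rewrite bigcup_seq; apply/bigcupP; exists j.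
Qed.

Hypothesis w_ge0 : forall v a, 0 <= w v a.

Lemma weight_ge0 s : 0 <= weight s.
Proof. exact: prodr_ge0. Qed.

Lemma le_expect f g : (forall s, f s <= g s) -> expect f <= expect g.
Proof. by move=> fg; apply: ler_sum => s _; rewrite ler_wpM2l ?weight_ge0. Qed.

(** If f < c everywhere, then E (c - f) is a sum of nonnegative terms and at most 0, so every weight
    vanishes, against total mass 1. *)
Lemma expect_witness f c : c <= expect f -> exists s, c <= f s.
Proof.
move=> cE; have [/existsP[s cs]|/existsPn nex] := boolP [exists s, c <= f s].
  by exists s.
suff /eqP c0 : expect (fun s => c - f s) == 0.
  have W0 s : weight s = 0.
    move/eqP: c0; rewrite /expect psumr_eq0 => [/allP/(_ s)|a _]; last first.
      by rewrite mulr_ge0 ?weight_ge0 // subr_ge0 ltW // ltNge nex.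
    rewrite mem_index_enum mulf_eq0 subr_eq0 => /(_ isT) /orP[/eqP //|/eqP E].
    by have := nex s; rewrite E lexx.
  have := expect_cst 1; rewrite /expect big1 => [/eqP|s _]; last by rewrite W0 mul0r.
  by rewrite eq_sym oner_eq0.
rewrite eq_le {1}expectB expect_cst subr_le0 cE.
by apply: sumr_ge0 => s _; rewrite mulr_ge0 ?weight_ge0 // subr_ge0 ltW // ltNge nex.
Qed.

End Expectation.

Local Close Scope ring_scope.

(** * Locally tree-like hypergraphs *)

Section LocallyTree.
Variables (V : finType) (E : {set {set V}}) (K : nat).

(* The vertices reached from v by non-backtracking walks of at most d steps whose
   first hyperedge is not h. *)
Fixpoint branch d (h : {set V}) (v : V) : {set V} :=
  if d is d'.+1 then
    v |: \bigcup_(h' in E | (v \in h') && (h' != h))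
           \bigcup_(u in h' :\ v) branch d' h' u
  else [set v].

Fixpoint span v (hs : seq {set V}) : {set V} :=
  if hs is h :: hs' then h :|: span v hs' else [set v].

(* Hypertrees are listed newest hyperedge first. *)
Fixpoint hypertree v (hs : seq {set V}) : bool :=
  if hs is h :: hs' then
    [&& h \in E, #|h :&: span v hs'| == 1 & hypertree v hs']
  else true.

(** The upper bound [K] leaves out hyperedges lying inside the span: the members of [hs] are such,
    and the sparsification controls codegrees only of sets of at most [K] vertices. *)
Definition cycle_closing v hs (h : {set V}) :=
  [&& hypertree v hs, h \in E & 1 < #|h :&: span v hs| <= K].

Definition locally_tree L :=
  forall v hs h, size hs < L -> ~~ cycle_closing v hs h.

Lemma mem_span_root v (hs : seq {set V}) : v \in span v hs.
Proof. by elim: hs => [|h hs IH] /=; rewrite !inE ?IH ?orbT ?eqxx. Qed.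

Lemma sub_span v (hs : seq {set V}) (h : {set V}) : h \in hs -> h \subset span v hs.
Proof.
elim: hs => //= a hs IH; rewrite inE => /predU1P[->|/IH]; first exact: subsetUl.
by move=> s; apply: subset_trans s (subsetUr _ _).
Qed.

Hypothesis E_unif : forall h, h \in E -> #|h| = K.+1.
Hypothesis K_gt1 : 1 < K.

Lemma card_span v hs : hypertree v hs -> #|span v hs| = (K * size hs).+1.
Proof.
elim: hs => [|h hs IH] /=; first by rewrite cards1 muln0.
case/and3P=> hE /eqP h1 /IH c; have := cardsUI h (span v hs).
by rewrite h1 c (E_unif hE) addn1 mulnS addSn addnS => -[->].
Qed.

Variable L : nat.
Hypotheses (L_gt1 : 1 < L) (treeE : locally_tree L).

(* If h met the span in K + 1 points while meeting the span of the tail in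
   at most one, it would meet the last hyperedge in at least K > 1 points. *)
Lemma hypertree_meet v hs (h : {set V}) : hypertree v hs -> size hs < L ->
  h \in E -> h \notin hs -> #|h :&: span v hs| <= 1.
Proof.
elim: hs => [|a hs IH] /=.
  by move=> _ _ _ _; rewrite (leq_trans (subset_leq_card (subsetIr _ _))) ?cards1.
move=> ta sz hE; have [aE _ t] := and3P ta.
rewrite inE negb_or => /andP[ha hhs].
have IHh := IH t (ltnW sz) hE hhs.
rewrite leqNgt; apply/negP => m1.
have := treeE v h (sz : size (a :: hs) < L); rewrite /cycle_closing /= ta hE m1 /= -ltnNge => mK.
have ah : K <= #|h :&: a|.
  rewrite -ltnS -(addn1 #|_|); apply: leq_trans mK _; rewrite setIUr.
  by apply: leq_trans (leq_card_setU _ _) _; rewrite leq_add2l.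
(* Rooted at one of its own vertices, [a] alone is a hypertree. Meeting it in at least K > 1 points
   without closing a cycle, [h] must contain all of [a], hence equal it. *)
have [x xa] : exists x, x \in a by apply/card_gt0P; rewrite (E_unif aE).
have := treeE x h (L_gt1 : size [:: a] < L).
rewrite /cycle_closing /= aE hE /= (setUidPl _) ?sub1set //.
rewrite (setIidPr _) ?sub1set // cards1 eqxx (leq_trans K_gt1 ah) /= -ltnNge => Kl.
case/negP: ha; rewrite eqEcard (E_unif aE) (E_unif hE) leqnn andbT.
apply/setIidPl/eqP; rewrite eqEcard subsetIl (E_unif hE); exact: Kl.
Qed.

Lemma hypertree_extend v hs (b : {set V}) y : hypertree v hs -> size hs < L ->
  b \in E -> b \notin hs -> y \in b -> y \in span v hs ->
  hypertree v (b :: hs) /\ b :&: span v hs = [set y].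
Proof.
move=> t sz bE bhs yb yU; have m := hypertree_meet t sz bE bhs.
have eqy : b :&: span v hs = [set y].
  by apply/esym/eqP; rewrite eqEcard sub1set inE yb yU cards1.
by split=> //=; rewrite bE eqy cards1.
Qed.

Lemma mem_branchP d b u w :
  w \in branch d.+1 b u -> w = u \/
  exists c x, [/\ c \in E, c != b & u \in c] /\
              [/\ x \in c, x != u & w \in branch d c x].
Proof.
case/setU1P=> [->|/bigcupP[c /and3P[cE uc cb] /bigcupP[x]]]; first by left.
by rewrite !inE => /andP[xu xc] wx; right; exists c, x; split.
Qed.

(** A walk in the branch extends the hypertree by one hyperedge per step. Each new hyperedge meets
    the current span only in the vertex through which it is entered, so the walk never comes back to
    the old span. *)
Lemma branch_disjoint_span d v hs (b : {set V}) y u w : hypertree v hs -> size hs + d < L ->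
  b \in E -> b \notin hs -> y \in b -> y \in span v hs -> u \in b -> u != y ->
  w \in branch d b u -> w \notin span v hs.
Proof.
elim: d hs b y u => [|d IH] hs b y u t sz bE bhs yb yU ub uy;
  have [t' eqy] := hypertree_extend t (leq_ltn_trans (leq_addr _ _) sz) bE bhs yb yU.
all: have uU : u \notin span v hs by
       apply: contra uy => uU; rewrite -in_set1 -eqy inE ub.
  by rewrite /= inE => /eqP->.
case/mem_branchP=> [->//|[c [x [[cE cb uc] [xc xu wx]]]]].
have chs : c \notin b :: hs.
  rewrite inE negb_or cb; apply: contra uU => chs.
  exact: (subsetP (sub_span v chs)).
have := IH (b :: hs) c u x t' _ cE chs uc _ xc xu wx.
by rewrite /= addSnnS sz !inE ub negb_or => /(_ isT isT) /andP[].
Qed.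

(** Here [ex] records the hyperedges of a walk from [u] to [w]. That they avoid the old span shows
    later that a hyperedge starting another branch at a vertex of that span is not among them. *)
Lemma branch_hypertree d v hs (b : {set V}) y u w : hypertree v hs -> size hs + d < L ->
  b \in E -> b \notin hs -> y \in b -> y \in span v hs -> u \in b -> u != y ->
  w \in branch d b u -> exists ex, [/\ hypertree v (ex ++ b :: hs), size ex <= d,
    w \in span v (ex ++ b :: hs) & {in ex, forall h : {set V}, [disjoint h & span v hs]}].
Proof.
elim: d hs b y u => [|d IH] hs b y u t sz bE bhs yb yU ub uy;
  have [t' eqy] := hypertree_extend t (leq_ltn_trans (leq_addr _ _) sz) bE bhs yb yU.
  by rewrite /= inE => /eqP->; exists [::]; split=> //=; rewrite inE ub.
have uU : u \notin span v hs by
  apply: contra uy => uU; rewrite -in_set1 -eqy inE ub.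
case/mem_branchP=> [->|[c [x [[cE cb uc] [xc xu wx]]]]].
  by exists [::]; split=> //=; rewrite inE ub.
have chs : c \notin b :: hs.
  rewrite inE negb_or cb; apply: contra uU => chs.
  exact: (subsetP (sub_span v chs)).
have sz' : size (b :: hs) + d < L by rewrite /= addSnnS.
have ubU : u \in span v (b :: hs) by rewrite /= inE ub.
have [ex [tex sex wex dex]] := IH (b :: hs) c u x t' sz' cE chs uc ubU xc xu wx.
have [_ equ] := hypertree_extend t' (leq_ltn_trans (leq_addr _ _) sz') cE chs uc ubU.
exists (rcons ex c); rewrite cat_rcons size_rcons; split=> // h.
have sU : span v hs \subset span v (b :: hs) by apply: subsetUr.
rewrite mem_rcons inE => /predU1P[->|/dex dh]; last exact: disjointWr dh.
rewrite -setI_eq0 -subset0; apply/subsetP=> z /setIP[zc zU].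
have : z \in c :&: span v (b :: hs) by rewrite inE zc (subsetP sU).
by rewrite equ inE => /eqP zu; rewrite -zu zU in uU.
Qed.

Lemma root_notin_branch d v (b : {set V}) u : d < L -> b \in E -> v \in b -> u \in b ->
  u != v -> v \notin branch d b u.
Proof.
move=> dL bE vb ub uv; apply/negP => vB.
have := @branch_disjoint_span d v [::] b v u v isT dL bE isT vb.
by rewrite /= !inE eqxx => /(_ isT ub uv vB).
Qed.

(** For a common vertex [w], grow a hypertree along the walk to [w] in the first branch. The second
    branch starts from its span with a fresh hyperedge, so by [branch_disjoint_span] it cannot reach
    [w]. *)
Lemma branches_disjoint d v (b b' : {set V}) u u' : (d + d).+2 < L ->
  b \in E -> b' \in E -> v \in b -> v \in b' -> u \in b -> u' \in b' ->
  u != v -> u' != v -> (b, u) != (b', u') ->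
  [disjoint branch d b u & branch d b' u'].
Proof.
move=> dL bE b'E vb vb' ub ub' uv uv' ne.
have dL1 : d < L by move: dL; clear; lia.
rewrite disjoint_subset; apply/subsetP => w wB; rewrite inE; apply/negP => wB'.
have vU : v \in span v [::] by rewrite inE.
have [eb|nb] := eqVneq b' b; last first.
  have [ex [tex sex wex dex]] := branch_hypertree (hs := [::]) isT dL1 bE isT vb vU ub uv wB.
  have nb' : b' \notin ex ++ [:: b].
    rewrite mem_cat inE negb_or nb andbT; apply/negP => /dex.
    by rewrite disjoint_sym => /disjointFr /(_ vU); rewrite vb'.
  have := branch_disjoint_span tex _ b'E nb' vb' (mem_span_root _ _) ub' uv' wB'.
  rewrite wex size_cat /= => /(_ _)/negP; apply=> //.
  by move: sex dL; clear; lia.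
(* Both branches now leave through the same [b], from distinct vertices [u] and [u']; the argument
   is repeated with base hypertree [[:: b]], the walks continuing through [c] at [u] and [c'] at
   [u']. *)
move: wB' ne b'E vb' ub'; rewrite {}eb => wB' + _ _ ub'; rewrite xpair_eqE eqxx /= => uu'.
case: d dL dL1 wB wB' => [|d] dL dL1.
  by rewrite /= !inE => /eqP-> /eqP uu; rewrite uu eqxx in uu'.
have dL2 : size [:: b] + d < L by [].
have tb : hypertree v [:: b].
  by rewrite /= bE (setIidPr _) ?sub1set // cards1.
have bU : b \subset span v [:: b] by apply: subsetUl.
have outb x c z z' : z \in b -> c \in E -> c != b -> z \in c -> x \in c -> x != z ->
    z' \in branch d c x -> z' \notin b.
  move=> zb cE cb zc xc xz zB; apply: contra (_ : z' \notin span v [:: b]).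
    exact: (subsetP bU).
  have cnb : c \notin [:: b] by rewrite inE.
  exact: branch_disjoint_span tb dL2 cE cnb zc (subsetP bU _ zb) xc xz zB.
case/mem_branchP=> [->|[c [x [[cE cb uc] [xc xu wx]]]]];
  (case/mem_branchP=> [|[c' [x' [[c'E cb' uc'] [xc' xu' wx']]]]]).
- by move=> uu; rewrite uu eqxx in uu'.
- by have := outb _ _ _ _ ub' c'E cb' uc' xc' xu' wx'; rewrite ub.
- by move=> wu; have := outb _ _ _ _ ub cE cb uc xc xu wx; rewrite wu ub'.
have cnb : c \notin [:: b] by rewrite inE.
have [ex [tex sex wex dex]] :=
  branch_hypertree tb dL2 cE cnb uc (subsetP bU _ ub) xc xu wx.
have [_ equ] := hypertree_extend tb L_gt1 cE cnb uc (subsetP bU _ ub).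
have u'U := subsetP bU _ ub'.
have nc' : c' \notin ex ++ [:: c; b].
  rewrite mem_cat !inE !negb_or (negPf cb') andbT; apply/andP; split.
    by apply/negP => /dex; rewrite disjoint_sym => /disjointFr /(_ u'U); rewrite uc'.
  apply/eqP => cc'; have: u' \in c :&: span v [:: b] by rewrite inE -cc' uc' u'U.
  by rewrite equ inE => /eqP e; rewrite e eqxx in uu'.
have u'U' : u' \in span v (ex ++ [:: c; b]).
  by apply: (subsetP (sub_span v (_ : b \in _))) => //; rewrite mem_cat !inE eqxx !orbT.
have := branch_disjoint_span tex _ c'E nc' uc' u'U' xc' xu' wx'.
rewrite wex size_cat /= => /(_ _)/negP; apply=> //.
by move: sex dL; clear; lia.
Qed.

End LocallyTree.

(** * The density recursion *)

Local Open Scope ring_scope.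

Section Density.
Variables (F : realFieldType) (K D M : nat).

(** The numbers b_i of the overview, with K = k - 1; the exponent [D.-1] counts the hyperedges at a
    vertex other than the one leading to it. *)
Fixpoint density i : F :=
  if i is j.+1 then
    density j + M%:R^-1 * (1 - density j ^+ K) ^+ D.-1
  else 0.

Lemma densityE i : density i = \sum_(j < i) M%:R^-1 * (1 - density j ^+ K) ^+ D.-1.
Proof. by elim: i => [|i IH]; rewrite ?big_ord0 // big_ord_recr /= -IH. Qed.

Hypothesis M_gt0 : (0 < M)%N.

Lemma density_bound i : (i <= M)%N -> 0 <= density i <= i%:R / M%:R.
Proof.
elim: i => [|i IH] iM /=; first by rewrite mul0r lexx.
have /andP[d0 d1] := IH (ltnW iM).
have d1' : density i <= 1.
  by rewrite (le_trans d1) // ler_pdivrMr ?ltr0n // mul1r ler_nat ltnW.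
have /andP[x0 x1] : 0 <= 1 - density i ^+ K <= 1.
  by rewrite subr_ge0 exprn_ile1 //= gerBl exprn_ge0.
rewrite addr_ge0 ?mulr_ge0 ?invr_ge0 ?ler0n ?exprn_ge0 //=.
rewrite -natr1 mulrDl mul1r lerD // ler_piMr ?invr_ge0 ?ler0n //.
exact: exprn_ile1.
Qed.

Lemma density01 i : (i <= M)%N -> 0 <= density i <= 1.
Proof.
move=> iM; have /andP[-> /= d1] := density_bound iM.
by rewrite (le_trans d1) // ler_pdivrMr ?ltr0n // mul1r ler_nat.
Qed.

Lemma free01 i : (i <= M)%N -> 0 <= 1 - density i ^+ K <= 1.
Proof.
move=> iM; have /andP[d0 d1] := density01 iM.
by rewrite subr_ge0 exprn_ile1 //= gerBl exprn_ge0.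
Qed.

(* Once the density exceeds z the accepted mass is already at least z / 2; as
   long as it stays below z, every step adds at least z / M. *)
Lemma accepted_mass z : (0 < D)%N -> 0 <= z -> z ^+ K <= 2^-1 ->
  z <= (1 - z ^+ K) ^+ D ->
  z / 2 <= \sum_(i < M) M%:R^-1 * (1 - density i ^+ K) ^+ D.
Proof.
move=> D0 z0 zh zD.
have [i [iM zi lti]] : exists i, [/\ (i <= M)%N, z <= density i
    & forall j, (j < i)%N -> density j < z].
  have: exists i, (i <= M)%N && (z <= density i).
    have [/existsP[i zi]|/existsPn nz] := boolP [exists i : 'I_M, z <= density i].
      by exists i; rewrite zi ltnW.
    (* If the density is below [z] at all times before [M], the [M] increments of at least z / M
       each bring it to [z] at time [M]. *)
    exists M; rewrite leqnn densityE.
    apply: le_trans (_ : \sum_(j < M) M%:R^-1 * z <= _).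
      rewrite sumr_const card_ord -[X in _ <= X *+ _]mulrC -mulrnAr -[M%:R^-1 *+ _]mulr_natr.
      by rewrite mulVf ?mulr1 // pnatr_eq0 -lt0n.
    apply: ler_sum => j _; rewrite ler_wpM2l ?invr_ge0 ?ler0n //.
    apply: le_trans zD _; rewrite -{1}(prednK D0).
    have /andP[f0 f1] := free01 (ltnW (ltn_ord j)).
    have jz : density j < z by rewrite ltNge nz.
    have /andP[dj0 _] := density01 (ltnW (ltn_ord j)).
    have zK0 : 0 <= 1 - z ^+ K by rewrite subr_ge0 (le_trans zh) // invf_le1 ?ler1n ?ltr0n.
    rewrite exprSr (le_trans (_ : _ <= (1 - z ^+ K) ^+ D.-1 * 1)) //.
      by rewrite ler_wpM2l ?exprn_ge0 // gerBl exprn_ge0.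
    by rewrite mulr1 lerXn2r ?nnegrE // lerB // lerXn2r ?nnegrE // ltW.
  move=> ex; exists (ex_minn ex); case: ex_minnP => i /andP[iM zi] mini.
  split=> // j ji; rewrite ltNge; apply/negP => zj.
  have := mini j; rewrite zj (leq_trans (ltnW ji) iM) leqNgt ji => /(_ isT).
  by [].
rewrite -(big_mkord xpredT (fun i => M%:R^-1 * (1 - density i ^+ K) ^+ D)).
rewrite (big_cat_nat (n := i)) //= -[leLHS]addr0 lerD //; last first.
  rewrite big_nat_cond; apply: sumr_ge0 => j /andP[/andP[_ jM] _].
  rewrite mulr_ge0 ?invr_ge0 ?ler0n // exprn_ge0 //.
  by have /andP[] := free01 (ltnW jM).
apply: le_trans (_ : density i / 2 <= _); first by rewrite ler_wpM2r ?invr_ge0 ?ler0n.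
(* The accepted mass has exponent [D] where the density has [D.-1]; the extra factor is at least
   1/2, since the density is still below [z] and z^K <= 1/2. *)
rewrite densityE mulr_suml big_mkord; apply: ler_sum => j _.
rewrite -mulrA ler_wpM2l ?invr_ge0 ?ler0n // -[in leRHS](prednK D0) exprSr.
have jM : (j <= M)%N by apply: leq_trans iM; apply: ltnW.
have /andP[f0 f1] := free01 jM; rewrite ler_wpM2l ?exprn_ge0 //.
have /andP[dj0 _] := density01 jM.
have : density j ^+ K <= 2^-1.
  by apply: le_trans zh; rewrite lerXn2r ?nnegrE // ltW // lti.
by clear; lra.
Qed.

End Density.

(** * The random greedy independent set *)

Lemma natr_forall (F : realFieldType) (I : finType) (P Q : pred I) :
  [forall (i | P i), Q i]%:R = \prod_(i | P i) (Q i)%:R :> F.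
Proof.
rewrite -big_andE; apply: (big_morph (fun b : bool => b%:R)) => // b c.
by rewrite -natrM mulnb.
Qed.

Lemma natr_ltn_sum (F : realFieldType) (m i : nat) (b : bool) :
  ((m < i)%N && b)%:R = \sum_(j < i) (b && (m == j))%:R :> F.
Proof.
case: ltnP => mi /=.
  rewrite (bigD1 (Ordinal mi)) //= eqxx andbT big1 ?addr0 // => j ne.
  by case: eqP => [e|]; rewrite ?andbF //; case/eqP: ne; apply: val_inj.
rewrite big1 // => j _; case: eqP; rewrite ?andbF // => e.
by have := ltn_ord j; rewrite -e ltnNge mi.
Qed.

Section Greedy.
Variables (F : realFieldType) (V : finType) (E : {set {set V}}) (K D M : nat).

Definition edges_at v : {set {set V}} := [set h in E | v \in h].

Hypothesis E_unif : forall h, h \in E -> #|h| = K.+1.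
Hypothesis deg_le : forall v, (#|edges_at v| <= D)%N.
Hypothesis M_gt0 : (0 < M)%N.
Hypothesis root_fresh : forall d v b u, (d <= M)%N ->
  b \in E -> v \in b -> u \in b -> u != v -> v \notin branch E d b u.
Hypothesis branch_fresh : forall d v b b' u u', (d <= M)%N ->
  b \in E -> b' \in E -> v \in b -> v \in b' -> u \in b -> u' \in b' ->
  u != v -> u' != v -> (b, u) != (b', u') ->
  [disjoint branch E d b u & branch E d b' u'].

Local Notation dens := (density F K D M).
Local Notation label := ('I_M.+1).

(* The label M means that the vertex never takes part.  The factor
   (1 - dens a ^+ K) ^+ (D - deg v) mimics D - deg v additional tree-like
   hyperedges at v, so that all vertices behave as in a D-regular hypertree. *)
Definition label_weight v (a : label) : F :=
  if (a < M)%N then M%:R^-1 * (1 - dens a ^+ K) ^+ (D - #|edges_at v|)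
  else 1 - \sum_(j < M) M%:R^-1 * (1 - dens j ^+ K) ^+ (D - #|edges_at v|).

Local Notation Ex := (expect label_weight).

(* The greedy process on the branch of v avoiding its parent hyperedge h: vertices
   are treated by increasing label, and v is rejected if it would complete a
   hyperedge.  The fuel d is sufficient once it exceeds the label of v. *)
Fixpoint accepted d (h : {set V}) v (s : {ffun V -> label}) : bool :=
  if d is d'.+1 then
    (s v < M)%N && [forall (h' | [&& h' \in E, v \in h' & h' != h]),
      ~~ [forall (u | u \in h' :\ v), (s u < s v)%N && accepted d' h' u s]]
  else false.

Lemma label_weight_le v (a : label) : (a < M)%N -> label_weight v a <= M%:R^-1.
Proof.
move=> aM; rewrite /label_weight aM ler_piMr ?invr_ge0 ?ler0n //.
by have /andP[f0 f1] := free01 F K D M_gt0 (ltnW aM); rewrite exprn_ile1.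
Qed.

Lemma label_weight_sum1 v : \sum_a label_weight v a = 1.
Proof.
rewrite big_ord_recr /= {2}/label_weight /= ltnn.
under eq_bigr do rewrite /label_weight /= ltn_ord.
by rewrite addrC subrK.
Qed.

Lemma label_weight_ge0 v a : 0 <= label_weight v a.
Proof.
rewrite /label_weight; case: ifP => aM.
  rewrite mulr_ge0 ?invr_ge0 ?ler0n // exprn_ge0 //.
  by have /andP[] := free01 F K D M_gt0 (ltnW aM).
rewrite subr_ge0 (le_trans (_ : _ <= \sum_(j < M) M%:R^-1)) //; last first.
  by rewrite sumr_const card_ord -[_^-1 *+ _]mulr_natr mulVf // pnatr_eq0 -lt0n.
apply: ler_sum => j _; rewrite ler_piMr ?invr_ge0 ?ler0n //.
by have /andP[f0 f1] := free01 F K D M_gt0 (ltnW (ltn_ord j)); rewrite exprn_ile1.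
Qed.

Lemma accepted_lt d h v s : accepted d h v s -> (s v < M)%N.
Proof. by case: d => //= d /andP[]. Qed.

Lemma eq_accepted d h v (s s' : {ffun V -> label}) :
  {in branch E d h v, s =1 s'} -> accepted d h v s = accepted d h v s'.
Proof.
elim: d h v => [//|d IH] h v ss' /=.
have sv : s v = s' v by apply: ss'; rewrite /= setU11.
rewrite sv; congr (_ && _); apply: eq_forallb => h'.
case C: [&& _, _ & _] => //=; congr (~~ _); apply: eq_forallb => u.
case uh: (u \in h' :\ v) => //=.
have sub w : w \in branch E d h' u -> w \in branch E d.+1 h v.
  move=> wB; apply/setUP; right; apply/bigcupP; exists h' => //.
  by apply/bigcupP; exists u.
have uB : u \in branch E d h' u by case: (d) => [|d'] /=; rewrite !inE eqxx.
by rewrite (ss' _ (sub _ uB)) (IH h' u) // => w /sub; apply: ss'.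
Qed.

(** Writes acceptance with label [i] as a product over the hyperedges at [v], whose factors live on
    different branches, so that independence applies. *)
Lemma accepted_natrE d h v i (s : {ffun V -> label}) : (i < M)%N ->
  (accepted d.+1 h v s && (s v == i :> nat))%:R = (s v == i :> nat)%:R *
    \prod_(h' | [&& h' \in E, v \in h' & h' != h])
       (1 - \prod_(u in h' :\ v) ((s u < i)%N && accepted d h' u s)%:R) :> F.
Proof.
move=> iM; rewrite [accepted _ _ _ _]/=; have [sv|] := eqVneq (s v : nat) i; last first.
  by rewrite andbF mul0r.
rewrite sv iM andbT mul1r natr_forall; apply: eq_bigr => h' _.
rewrite -(natr_forall F (fun u => u \in h' :\ v)
  (fun u => (s u < i)%N && accepted d h' u s)).
by case: [forall (_ | _), _]; rewrite ?subrr ?subr0.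
Qed.

(** Given label [i] at [v], the [K] other vertices of a hyperedge are all accepted earlier with
    probability b_i^K, and different hyperedges are independent. The two powers come from the label
    law and from the actual hyperedges. *)
Lemma accepted_step d h v i : (d <= M)%N -> (i < M)%N ->
    (forall h' u, h' \in E -> u \in h' ->
       Ex (fun s => ((s u < i)%N && accepted d h' u s)%:R) = dens i) ->
  Ex (fun s => (accepted d.+1 h v s && (s v == i :> nat))%:R) =
  M%:R^-1 * (1 - dens i ^+ K) ^+ (D - #|edges_at v|)
    * (1 - dens i ^+ K) ^+ #|[set h' in edges_at v | h' != h]|.
Proof.
move=> dM iM IH; under eq_expect do rewrite accepted_natrE //.
pose P h' := [&& h' \in E, v \in h' & h' != h].
pose A h' := \bigcup_(u in h' :\ v) branch E d h' u.
pose f h' (s : {ffun V -> label}) : F :=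
  1 - \prod_(u in h' :\ v) ((s u < i)%N && accepted d h' u s)%:R.
have uB h' u : u \in branch E d h' u by case: (d) => [|d'] /=; rewrite !inE eqxx.
have dep1 h' u : depends_on (branch E d h' u)
    (fun s : {ffun V -> label} => ((s u < i)%N && accepted d h' u s)%:R : F).
  by move=> s s' ss'; rewrite (eq_accepted ss') ss'.
have depf h' : depends_on (A h') (f h').
  move=> s s' ss'; congr (1 - _); apply: eq_bigr => u uh.
  by apply: dep1 => w wB; apply: ss'; apply/bigcupP; exists u.
have dA h1 h2 : P h1 -> P h2 -> h1 != h2 -> [disjoint A h1 & A h2].
  move=> /and3P[E1 v1 _] /and3P[E2 v2 _] h12.
  apply/bigcup_disjointP => u2; rewrite !inE => /andP[uv2 u2h].
  rewrite disjoint_sym; apply/bigcup_disjointP => u1; rewrite !inE => /andP[uv1 u1h].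
  apply: (branch_fresh dM E2 E1 v2 v1) => //.
  by rewrite xpair_eqE negb_and eq_sym h12.
have Ef h' : P h' -> Ex (f h') = 1 - dens i ^+ K.
  move=> /and3P[hE vh _]; rewrite /f expectB expect_cst; last exact: label_weight_sum1.
  congr (1 - _); rewrite (expect_prod_indep label_weight_sum1 (A := branch E d h')).
  - under eq_bigr => u do [rewrite !inE => /andP[_ uh]; rewrite IH //].
    by rewrite prodr_const; congr (_ ^+ _); have := cardsD1 v h'; rewrite vh E_unif // => -[->].
  - by move=> u _; apply: dep1.
  - move=> u1 u2; rewrite !inE => /andP[uv1 u1h] /andP[uv2 u2h] u12.
    apply: (branch_fresh dM hE hE vh vh) => //.
    by rewrite xpair_eqE negb_and u12 orbT.
rewrite (expect_indep label_weight_sum1 (A := [set v]) (B := \bigcup_(h' | P h') A h')).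
- congr (_ * _).
    rewrite (expect_coord label_weight_sum1 v (fun a : label => (a == i :> nat)%:R)).
    rewrite (bigD1 (inord i)) //= big1 ?addr0.
      by rewrite inordK ?eqxx ?mulr1 /label_weight ?inordK ?iM // ltnW.
    move=> a ai; case: eqP => [e|]; last by rewrite mulr0.
    by case/eqP: ai; apply: val_inj; rewrite /= inordK // ltnW.
  rewrite (expect_prod_indep label_weight_sum1 (A := A)) //.
  rewrite (eq_bigr _ Ef) prodr_const; congr (_ ^+ _).
  by apply: eq_card => h'; rewrite !inE unfold_in /= andbA.
- apply/bigcup_disjointP => h' /and3P[hE vh _]; apply/bigcup_disjointP => u.
  rewrite !inE => /andP[uv uh]; rewrite disjoints1.
  exact: root_fresh.
- by move=> s s' ss'; rewrite ss' ?set11.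
- move=> s s' ss'; apply: eq_bigr => h' Ph; apply: depf => w wA.
  by apply: ss'; apply/bigcupP; exists h'.
Qed.

(** The simulated and the actual hyperedges, the parent [h] excepted, add up to [D.-1] whatever the
    degree of [v]. Summation over the labels below [i] gives [dens i], which feeds the induction on
    the fuel. *)
Lemma accepted_prob d h v i : (i < d)%N -> (d <= M)%N -> h \in E -> v \in h ->
  Ex (fun s => (accepted d h v s && (s v == i :> nat))%:R) =
  M%:R^-1 * (1 - dens i ^+ K) ^+ D.-1.
Proof.
elim: d h v i => // d IH h v i id dM hE vh.
have iM : (i < M)%N by apply: leq_trans dM.
rewrite accepted_step // 1?ltnW //; last first.
  move=> h' u h'E uh; rewrite densityE.
  under eq_expect do rewrite natr_ltn_sum.
  rewrite expect_sum; apply: eq_bigr => j _; apply: IH => //; last exact: ltnW.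
  by apply: leq_trans (ltn_ord j) _.
rewrite -mulrA -exprD; congr (_ * _ ^+ _).
have := deg_le v; rewrite (cardsD1 h (edges_at v)) !inE hE vh /=.
have -> : [set h' in edges_at v | h' != h] = edges_at v :\ h.
  by apply/setP => h'; rewrite !inE andbC.
case: (D) => [//|D']; rewrite add1n ltnS subSS /= => le.
by rewrite subnK.
Qed.

(** The parent [set0] is not a hyperedge, so nothing is excluded at the root and the exponent is
    [D]. *)
Lemma accepted_root_prob v :
  Ex (fun s => (accepted M set0 v s)%:R) =
  \sum_(i < M) M%:R^-1 * (1 - dens i ^+ K) ^+ D.
Proof.
have accM s : accepted M set0 v s = (s v < M)%N && accepted M set0 v s.
  by case A: (accepted _ _ _ _); rewrite ?andbF ?(accepted_lt A).
under eq_expect do rewrite accM natr_ltn_sum.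
rewrite expect_sum; apply: eq_bigr => i _.
have iM := ltn_ord i.
have := @accepted_step M.-1 set0 v i (leq_pred M) iM.
rewrite prednK // => ->.
  rewrite -mulrA -exprD; congr (_ * _ ^+ _).
  rewrite -[RHS](subnK (deg_le v)); congr (_ + _)%N; apply: eq_card => h.
  rewrite !inE; case hE: (h \in E) => //=; case: (v \in h) => //=.
  by apply/eqP => h0; have := E_unif hE; rewrite h0 cards0.
move=> h' u h'E uh; rewrite densityE.
under eq_expect do rewrite natr_ltn_sum.
rewrite expect_sum; apply: eq_bigr => j _; apply: accepted_prob => //.
  by apply: leq_trans (ltn_ord j) _; rewrite -ltnS prednK.
exact: leq_pred.
Qed.

Lemma accepted_weaken d h v s : accepted d set0 v s -> accepted d h v s.
Proof.
case: d => //= d /andP[-> /forallP acc]; apply/forallP => h'.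
apply/implyP => /and3P[hE vh _]; apply: implyP (acc h') _.
rewrite hE vh /=; apply/eqP => h0; have := E_unif hE.
by rewrite h0 cards0.
Qed.

(** The recursion consults only strictly smaller labels, so its depth is bounded by the label of
    [v]. *)
Lemma accepted_fuel d h v (s : {ffun V -> label}) : (s v < d)%N ->
  accepted d h v s = accepted d.+1 h v s.
Proof.
elim: d h v => // d IH h v sv; rewrite [LHS]/= [RHS]/=; congr (_ && _).
apply: eq_forallb => h'; congr (_ ==> ~~ _); apply: eq_forallb => u.
congr (_ ==> _); case: ltnP => //= su; apply: IH.
exact: leq_trans su _.
Qed.

(** Ties are the price of discrete labels: vertices with equal labels ignore each other and may
    jointly complete a hyperedge. *)
Definition tied (s : {ffun V -> label}) (h : {set V}) :=
  [exists u in h, exists u' in h, [&& u != u', s u == s u' & (s u < M)%N]].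

(** Look at a vertex [v] of [h] with the largest label. Its acceptance needs another vertex of [h]
    that is rejected or has no smaller label; as all are accepted, some label equals that of [v]. *)
Lemma accepted_tied s h : h \in E -> (forall v, v \in h -> accepted M set0 v s) ->
  tied s h.
Proof.
move=> hE acc; have [v0 v0h] : exists v, v \in h.
  by apply/card_gt0P; rewrite E_unif.
case: (@arg_maxnP V v0 (fun v => v \in h) (fun v => s v) v0h) => v vh maxv.
have: accepted M.-1.+1 set0 v s by rewrite prednK //; apply: acc.
rewrite [accepted _ _ _ _]/= => /andP[sv /forallP/(_ h)].
have -> : h != set0 by rewrite -card_gt0 E_unif.
rewrite hE vh implyTb.
rewrite negb_forall => /existsP[u]; rewrite negb_imply !inE => /andP[/andP[uv uh]].
have [su|su] := ltnP (s u) (s v).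
  rewrite andTb accepted_fuel ?prednK //; first by rewrite accepted_weaken ?acc.
  by rewrite -ltnS prednK // (leq_ltn_trans su).
move=> _; apply/existsP; exists u; rewrite uh; apply/existsP; exists v.
rewrite vh uv; have e : s u = s v by apply/val_inj/eqP; rewrite eqn_leq su andbT; apply: maxv.
by rewrite e eqxx.
Qed.

(** Union bound over ordered pairs of distinct vertices of [h]: given one label below [M], the other
    takes the same value with probability at most 1 / M. *)
Lemma tied_prob h : h \in E ->
  Ex (fun s => (tied s h)%:R) <= (K.+1 ^ 2)%:R / M%:R.
Proof.
move=> hE.
pose g u u' (s : {ffun V -> label}) : F :=
  \sum_(a : label | (a < M)%N) (s u == a)%:R * (s u' == a)%:R.
have g0 u u' s : 0 <= g u u' s.
  by apply: sumr_ge0 => a _; rewrite mulr_ge0 ?ler0n.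
have le1 s : (tied s h)%:R <= \sum_(u in h) \sum_(u' in h | u' != u) g u u' s.
  case T: (tied s h); last by do 2![apply: sumr_ge0 => ? _].
  have /existsP[u /andP[uh /existsP[u' /and4P[u'h uu' /eqP suu sM]]]] := T.
  rewrite (bigD1 u) //= -[leLHS]addr0 lerD //; last by do 2![apply: sumr_ge0 => ? _].
  rewrite (bigD1 u') /= ?u'h 1?eq_sym // -[leLHS]addr0 lerD //; last first.
    by apply: sumr_ge0 => ? _.
  rewrite /g (bigD1 (s u)) //= eqxx -suu eqxx mulr1 lerDl.
  by apply: sumr_ge0 => a _; rewrite mulr_ge0 ?ler0n.
have gE u u' : u' != u -> Ex (g u u') <= M%:R^-1.
  move=> uu'; rewrite expect_sum.
  apply: le_trans (_ : \sum_a M%:R^-1 * label_weight u' a <= _); last first.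
    by rewrite -mulr_sumr label_weight_sum1 mulr1.
  rewrite [leRHS](bigID (fun a : label => (a < M)%N)) /= -[leLHS]addr0 lerD //.
    apply: ler_sum => a aM.
    rewrite (expect_indep label_weight_sum1 (A := [set u]) (B := [set u'])).
    - rewrite (expect_coord label_weight_sum1 u (fun b => (b == a)%:R)).
      rewrite (expect_coord label_weight_sum1 u' (fun b => (b == a)%:R)).
      have one x : \sum_b label_weight x b * (b == a)%:R = label_weight x a.
        rewrite (bigD1 a) //= eqxx mulr1 big1 ?addr0 // => b /negPf->.
        by rewrite mulr0.
      by rewrite !one ler_wpM2r ?label_weight_ge0 // label_weight_le.
    - by rewrite disjoints1 inE eq_sym.
    - by move=> s s' ss'; rewrite ss' ?set11.
    - by move=> s s' ss'; rewrite ss' ?set11.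
  by apply: sumr_ge0 => a _; rewrite mulr_ge0 ?invr_ge0 ?ler0n ?label_weight_ge0.
apply: le_trans (le_expect label_weight_ge0 le1) _.
rewrite expect_sum (le_trans (_ : _ <= \sum_(u in h) K.+1%:R / M%:R)) //; last first.
  rewrite sumr_const (E_unif hE) -[_ / _ *+ _]mulr_natl mulrA -natrM.
  by rewrite lexx.
apply: ler_sum => u uh; rewrite expect_sum.
apply: le_trans (_ : \sum_(u' in h) M%:R^-1 <= _).
  rewrite [leRHS](bigID (fun u' => u' != u)) /= -[leLHS]addr0 lerD //.
    by apply: ler_sum => u' /andP[_]; apply: gE.
  by apply: sumr_ge0 => *; rewrite invr_ge0 ler0n.
by rewrite sumr_const (E_unif hE) -[_^-1 *+ _]mulr_natl.
Qed.

Lemma card_edges_le (X : {set V}) : (forall h, h \in E -> h \subset X) ->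
  (#|E| <= #|X| * D)%N.
Proof.
move=> EX; apply: leq_trans (_ : \sum_(v in X) #|edges_at v| <= _)%N; last first.
  by rewrite -sum_nat_const leq_sum.
rewrite -sum1_card.
have -> : (\sum_(v in X) #|edges_at v| = \sum_(h in E) \sum_(v in X | v \in h) 1)%N.
  rewrite (exchange_big_dep (mem X)) /=; last by move=> h v _ /andP[].
  apply: eq_bigr => v vX; rewrite sum1dep_card; apply: eq_card => h.
  by rewrite !inE vX.
apply: leq_sum => h hE; rewrite sum1dep_card.
apply: leq_trans (_ : #|h| <= _)%N; first by rewrite E_unif.
by apply: subset_leq_card; apply/subsetP => v vh; rewrite !inE vh (subsetP (EX h hE)).
Qed.

(** Alteration: from the accepted vertices of [X], one chosen vertex of every tied hyperedge is
    deleted. There are at most |X| D hyperedges, each tied with probability at most (K + 1)^2 /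
    M. *)
Lemma greedy_independent (X : {set V}) : (forall h, h \in E -> h \subset X) ->
  exists I : {set V}, [/\ I \subset X, forall h, h \in E -> ~~ (h \subset I) &
    #|X|%:R * (\sum_(i < M) M%:R^-1 * (1 - dens i ^+ K) ^+ D
               - (D * K.+1 ^ 2)%:R / M%:R) <= #|I|%:R].
Proof.
move=> EX.
pose A (s : {ffun V -> label}) := [set v in X | accepted M set0 v s].
pose T s := [set h in E | tied s h].
have cA s : #|A s|%:R = \sum_(v in X) (accepted M set0 v s)%:R :> F.
  rewrite -sum1dep_card natr_sum big_mkcondr /=.
  by apply: eq_bigr => v _; case: ifP.
have cT s : #|T s|%:R = \sum_(h in E) (tied s h)%:R :> F.
  rewrite -sum1dep_card natr_sum big_mkcondr /=.
  by apply: eq_bigr => v _; case: ifP.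
have [s fs] : exists s, #|X|%:R * (\sum_(i < M) M%:R^-1 * (1 - dens i ^+ K) ^+ D
               - (D * K.+1 ^ 2)%:R / M%:R) <= #|A s|%:R - #|T s|%:R :> F.
  apply: (expect_witness label_weight_sum1 label_weight_ge0).
  rewrite expectB mulrBr; apply: lerB.
    under eq_expect do rewrite cA.
    rewrite expect_sum.
    rewrite (eq_bigr _ (fun v (_ : v \in X) => accepted_root_prob v)).
    by rewrite sumr_const mulr_natl.
  under eq_expect do rewrite cT.
  rewrite expect_sum (le_trans (_ : _ <= \sum_(h in E) (K.+1 ^ 2)%:R / M%:R)) //.
    by apply: ler_sum => h; apply: tied_prob.
  rewrite sumr_const -[_ / _ *+ _]mulr_natl !mulrA -!natrM.
  rewrite ler_wpM2r ?invr_ge0 ?ler0n // ler_nat mulnA leq_mul2r.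
  by rewrite card_edges_le ?orbT.
pose R := [set v | Some v \in [set [pick x in h] | h : {set V} in T s]].
have cR : (#|R| <= #|T s|)%N.
  rewrite -(card_imset _ (@Some_inj _)); 
  apply: leq_trans (leq_imset_card (fun h : {set V} => [pick x in h]) (mem (T s))).
  apply: subset_leq_card; apply/subsetP => _ /imsetP[v vR ->].
  by rewrite inE in vR.
exists (A s :\: R); split.
- by apply/subsetP => v; rewrite !inE => /andP[_ /andP[]].
- move=> h hE; apply/negP => /subsetP hI.
  have hT : h \in T s.
    rewrite inE hE accepted_tied // => v /hI.
    by rewrite !inE => /andP[_ /andP[]].
  have [x xh] : exists x, x \in h by apply/card_gt0P; rewrite E_unif.
  case P: [pick x in h] => [y|]; last first.
    by case: pickP P => // /(_ x); rewrite xh.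
  have yh : y \in h by case: pickP P => // z zh [<-].
  have := hI _ yh; rewrite !inE; case/andP => /negP[].
  by apply/imsetP; exists h.
- apply: le_trans fs _; rewrite lerBlDr -natrD ler_nat.
  rewrite -(cardsID R (A s)) addnC leq_add2l.
  by apply: leq_trans (subset_leq_card (subsetIr _ _)) cR.
Qed.

End Greedy.

(** * Random sparsification *)

(** Markov's inequality in counting form. *)
Lemma card_large_le (F : realFieldType) (V : finType) (X : {set V}) (g : V -> F) c :
  0 <= c -> (forall v, 0 <= g v) ->
  c * #|[set v in X | c <= g v]|%:R <= \sum_(v in X) g v.
Proof.
move=> c0 g0; rewrite mulr_natr -sumr_const.
rewrite [leRHS](bigID (fun v => c <= g v)) /= -[leLHS]addr0 lerD ?sumr_ge0 //.
rewrite [leLHS](eq_bigl (fun v => (v \in X) && (c <= g v))); last by move=> v; rewrite inE.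
by apply: ler_sum => v /andP[].
Qed.

Section Sparsify.
Variables (F : realFieldType) (V : finType) (E : {set {set V}}) (X0 : {set V}).
Variables (K D L : nat) (p eta : F).

Definition codegree (J : {set V}) := #|[set h in E | J \subset h]|.

Hypothesis E_unif : forall h, h \in E -> #|h| = K.+1.
Hypotheses (D_gt0 : (0 < D)%N) (L_gt0 : (0 < L)%N) (p_ge0 : 0 <= p) (p_le1 : p <= 1).
Hypothesis eta_ge0 : 0 <= eta.
Hypothesis codegree1 : forall v, (codegree [set v])%:R * p ^+ K <= D%:R / 4.
Hypothesis codegreeJ : forall J : {set V}, (1 < #|J| <= K)%N ->
  (codegree J)%:R * p ^+ (K.+1 - #|J|) <= eta.
Hypothesis eta_small :
  4 * ((K.+1 * L * D).+1 ^ L * 2 ^ (K.+1 * L))%:R * eta <= 1.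

Definition coin (_ : V) (b : bool) : F := if b then p else 1 - p.

Local Notation Ex := (expect coin).

Lemma coin_sum1 v : \sum_b coin v b = 1.
Proof. by rewrite big_bool /= addrC subrK. Qed.

Lemma coin_ge0 v b : 0 <= coin v b.
Proof. by case: b => //=; rewrite subr_ge0. Qed.

Definition inside (U : {set V}) (s : {ffun V -> bool}) : F :=
  [forall (v | v \in U), s v]%:R.

Lemma inside_ge0 U s : 0 <= inside U s.
Proof. exact: ler0n. Qed.

Lemma expect_inside U : Ex (inside U) = p ^+ #|U|.
Proof.
have E1 s : inside U s = \prod_v (if v \in U then (s v)%:R else 1).
  by rewrite /inside natr_forall big_mkcond.
under eq_expect do rewrite E1.
rewrite (expect_prod_coord coin (fun v b => if v \in U then b%:R else 1)).
rewrite -prodr_const [RHS]big_mkcond; apply: eq_bigr => v _.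
rewrite big_bool /=; case: ifP => _; rewrite !mulr1 ?mulr0 ?addr0 //.
by rewrite addrC subrK.
Qed.

(* Dominates the number of cycle-closing extensions, by at most d + 1
   hyperedges, of the hypertree hs inside the random set. *)
Fixpoint closings d v hs (s : {ffun V -> bool}) : F :=
  \sum_(h in E | (1 < #|h :&: span v hs| <= K)%N) inside (h :|: span v hs) s +
  (if d is d'.+1 then
     \sum_(h in E | #|h :&: span v hs| == 1%N) closings d' v (h :: hs) s
   else 0).

Lemma closings_ge0 d v hs s : 0 <= closings d v hs s.
Proof.
elim: d hs => [|d IH] hs /=; rewrite addr_ge0 //.
- by apply: sumr_ge0 => h _; apply: inside_ge0.
- by apply: sumr_ge0 => h _; apply: inside_ge0.
- by apply: sumr_ge0.
Qed.

(** A span has at most [K.+1 * L] vertices. Accordingly [beta] bounds the closing hyperedges over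
    all intersections with the span, and [Q] the ways to attach one more hyperedge, both weighted by
    the survival of the new vertices. *)
Let beta : F := (2 ^ (K.+1 * L))%:R * eta.
Let Q : F := (K.+1 * L * D)%:R.

Lemma beta_ge0 : 0 <= beta.
Proof. by rewrite mulr_ge0 ?ler0n. Qed.

Lemma card_span_le v hs : hypertree E v hs -> (size hs <= L)%N ->
  (#|span v hs| <= K.+1 * L)%N.
Proof.
move=> t sz; rewrite (card_span E_unif t) mulSn -add1n leq_add // leq_mul2l.
by rewrite sz orbT.
Qed.

(** Hyperedges are sorted by their trace [J] on the span. There are at most 2^|U| traces, and
    [codegreeJ] bounds the contribution of each by p^|U| eta. *)
Lemma expect_last v hs : hypertree E v hs -> (size hs <= L)%N ->
  \sum_(h in E | (1 < #|h :&: span v hs| <= K)%N) p ^+ #|h :|: span v hs|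
  <= p ^+ #|span v hs| * beta.
Proof.
move=> t sz; set U := span v hs.
have cU : (#|U| <= K.+1 * L)%N by apply: card_span_le.
rewrite (partition_big (fun h => h :&: U) (fun J => (J \in powerset U) && (1 < #|J| <= K)%N)) /=;
  last by move=> h /andP[hE ->]; rewrite inE subsetIr.
apply: le_trans (_ : \sum_(J in powerset U) p ^+ #|U| * eta <= _); last first.
  rewrite sumr_const card_powerset -[_ *+ (2 ^ _)]mulr_natl mulrCA.
  rewrite ler_wpM2l ?exprn_ge0 // ler_wpM2r // ler_nat leq_pexp2l //.
rewrite [leRHS](bigID (fun J : {set V} => (1 < #|J| <= K)%N)) /= -[leLHS]addr0 lerD //;
  last by apply: sumr_ge0 => J _; rewrite mulr_ge0 ?exprn_ge0.
apply: ler_sum => J /andP[JU Jc].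
apply: le_trans (_ : \sum_(h in [set h in E | J \subset h]) p ^+ (#|U| + (K.+1 - #|J|)) <= _);
  last first.
  by rewrite sumr_const exprD -mulrnAr -[_ *+ _]mulr_natl ler_wpM2l ?exprn_ge0 // codegreeJ.
rewrite [leRHS](bigID (fun h : {set V} => h :&: U == J)) /= -[leLHS]addr0 lerD //;
  last by apply: sumr_ge0 => h _; rewrite exprn_ge0.
rewrite le_eqVlt; apply/orP; left; apply/eqP; apply: eq_big => h.
  rewrite !inE; case hE: (h \in E) => //=.
  case: eqP => [e|_]; last by rewrite !andbF.
  by rewrite e Jc -e subsetIl.
case/andP=> /andP[hE _] /eqP e; congr (_ ^+ _).
have := cardsUI h U; rewrite e (E_unif hE) => c.
have JK : (#|J| <= K.+1)%N by case/andP: Jc => _ /leqW.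
by rewrite addnBA // addnC -c addnK.
Qed.

(** Attaching a hyperedge at one vertex of the span costs a factor p^K against at most [codegree
    [set u]] choices, hence at most [Q] in total; closing at once or going on gives the factor 1 + Q
    per step. *)
Lemma expect_closings d v hs : hypertree E v hs -> (size hs + d <= L)%N ->
  Ex (closings d v hs) <= p ^+ #|span v hs| * (beta * (1 + Q) ^+ d).
Proof.
elim: d hs => [|d IH] hs t sz.
  rewrite addn0 in sz; rewrite expr0 mulr1 /=.
  under eq_expect do rewrite addr0.
  rewrite expect_sum; under eq_bigr do rewrite expect_inside.
  exact: expect_last.
have sz' : (size hs <= L)%N by apply: leq_trans sz; apply: leq_addr.
set U := span v hs.
have cU : (#|U| <= K.+1 * L)%N by apply: card_span_le.
have Q1 : 1 <= (1 + Q) ^+ d by apply: exprn_ege1; rewrite lerDl ler0n.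
have -> : Ex (closings d.+1 v hs) =
    \sum_(h in E | (1 < #|h :&: U| <= K)%N) Ex (inside (h :|: U)) +
    \sum_(h in E | #|h :&: U| == 1%N) Ex (closings d v (h :: hs)).
  rewrite -!expect_sum /expect -big_split; apply: eq_bigr => s _ /=.
  by rewrite -mulrDr.
under eq_bigr do rewrite expect_inside.
have le2 : \sum_(h in E | #|h :&: U| == 1%N) Ex (closings d v (h :: hs)) <=
    p ^+ #|U| * (Q * (beta * (1 + Q) ^+ d)).
  set c := beta * _; have c0 : 0 <= c by rewrite mulr_ge0 ?beta_ge0 // (le_trans ler01).
  apply: le_trans (_ : \sum_(h in E | #|h :&: U| == 1%N) p ^+ #|U| * (p ^+ K * c) <= _).
    apply: ler_sum => h /andP[hE h1].
    have t' : hypertree E v (h :: hs) by rewrite /= hE h1.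
    apply: le_trans (IH _ t' _) _; first by rewrite /= addSnnS.
    rewrite [in leRHS]mulrA -exprD /= -/U -/c.
    have := cardsUI h U; rewrite (eqP h1) (E_unif hE) addn1 addSn => -[->].
    by rewrite addnC.
  rewrite -mulr_sumr ler_wpM2l ?exprn_ge0 //.
  apply: le_trans (_ : \sum_(u in U) \sum_(h in [set h in E | [set u] \subset h]) p ^+ K * c <= _).
    rewrite (exchange_big_dep (mem E)) /=; last by move=> u h _; rewrite inE => /andP[].
    rewrite big_mkcondr /=; apply: ler_sum => h hE.
    case: ifP => [/cards1P[u hu]|_]; last first.
      by apply: sumr_ge0 => *; rewrite mulr_ge0 ?exprn_ge0.
    have /setIP[uh uU] : u \in h :&: U by rewrite hu set11.
    rewrite (bigD1 u) /=; last by rewrite uU inE hE sub1set.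
    by rewrite lerDl; apply: sumr_ge0 => *; rewrite mulr_ge0 ?exprn_ge0.
  apply: le_trans (_ : \sum_(u in U) D%:R * c <= _).
    apply: ler_sum => u _; rewrite sumr_const -[_ *+ #|_|]mulr_natl mulrA ler_wpM2r //.
    apply: le_trans (codegree1 u) _; rewrite ler_piMr ?ler0n //.
    by rewrite invf_le1 ?ler1n ?ltr0n.
  rewrite sumr_const -[_ *+ #|_|]mulr_natl mulrA -natrM ler_wpM2r // ler_nat.
  by rewrite leq_mul2r cU orbT.
apply: le_trans (lerD (expect_last t sz') le2) _; rewrite -mulrDr ler_wpM2l ?exprn_ge0 //.
by rewrite exprS [leRHS]mulrCA [leRHS]mulrDl mul1r lerD // ler_peMr ?beta_ge0.
Qed.

Lemma closings_ge1 d v ex hs h (s : {ffun V -> bool}) :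
  hypertree E v (ex ++ hs) -> h \in E -> (size ex <= d)%N ->
  (1 < #|h :&: span v (ex ++ hs)| <= K)%N ->
  (forall x, x \in h :|: span v (ex ++ hs) -> s x) ->
  1 <= closings d v hs s.
Proof.
elim: d ex hs => [|d IH] ex hs t hE sz hc ins.
all: have [e0|ne] := eqVneq ex [::].
- rewrite e0 /= in hc ins *; rewrite addr0 (bigD1 h) /= ?hE //.
  have -> : inside (h :|: span v hs) s = 1.
    by rewrite /inside; case: forallP => // -[] x; apply/implyP => /ins.
  by rewrite lerDl; apply: sumr_ge0 => *; apply: inside_ge0.
- by case: ex ne sz {t hc ins}.
- rewrite e0 /= in hc ins *; rewrite -[1]addr0 lerD //; last first.
    by apply: sumr_ge0 => *; apply: closings_ge0.
  rewrite (bigD1 h) /= ?hE //.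
  have -> : inside (h :|: span v hs) s = 1.
    by rewrite /inside; case: forallP => // -[] x; apply/implyP => /ins.
  by rewrite lerDl; apply: sumr_ge0 => *; apply: inside_ge0.
(* Lists are newest first while [closings] adds the oldest hyperedge first, so the last element of
   [ex] is the one to move onto [hs]. *)
case/lastP: ex ne sz t hc ins => // ex a _; rewrite size_rcons ltnS cat_rcons.
move=> sz t hc ins; rewrite [closings _ _ _ _]/=.
have /and3P[aE a1 _] : hypertree E v (a :: hs).
  by elim: (ex) t => //= b ex' IHex /and3P[_ _ /IHex].
rewrite -[1]add0r lerD //; first by apply: sumr_ge0 => *; apply: inside_ge0.
rewrite (bigD1 a) ?aE //= -[1]addr0 lerD //; first exact: IH t hE sz hc ins.
by apply: sumr_ge0 => *; apply: closings_ge0.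
Qed.

(** Alteration of the random subset [Rs s] of [X0], of mean size |X0| p: removing the vertices of
    large degree ([B1]) and the roots of closed cycles ([B2]) costs in expectation at most a quarter
    of this each. *)
Lemma sparsify : exists X : {set V},
  [/\ X \subset X0, #|X0|%:R * p / 2 <= #|X|%:R,
      forall v, (#|edges_at [set h in E | h \subset X] v| <= D)%N &
      locally_tree [set h in E | h \subset X] K L].
Proof.
pose Rs (s : {ffun V -> bool}) := [set v in X0 | s v].
pose dg v s : F := \sum_(h in [set h in E | [set v] \subset h]) inside h s.
pose f s : F := #|Rs s|%:R - D%:R^-1 * (\sum_(v in X0) dg v s)
                - \sum_(v in X0) closings L v [::] s.
have cR s : #|Rs s|%:R = \sum_(v in X0) (s v)%:R :> F.
  rewrite -sum1dep_card natr_sum big_mkcondr /=.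
  by apply: eq_bigr => v _; case: ifP.
have [s fs] : exists s, #|X0|%:R * p / 2 <= f s.
  apply: (expect_witness coin_sum1 coin_ge0).
  rewrite /f !expectB expectZ !expect_sum.
  have -> : Ex (fun s => #|Rs s|%:R) = #|X0|%:R * p.
    under eq_expect do rewrite cR.
    rewrite expect_sum mulr_natl -sumr_const.
    apply: eq_bigr => v _.
    rewrite (expect_coord coin_sum1 v (fun b => b%:R)) big_bool /= mulr1 mulr0.
    by rewrite addr0.
  have le1 : D%:R^-1 * (\sum_(v in X0) Ex (dg v)) <= #|X0|%:R * p / 4.
    rewrite ler_pdivrMl ?ltr0n //.
    apply: le_trans (_ : \sum_(v in X0) p * (D%:R / 4) <= _).
      apply: ler_sum => v _; rewrite expect_sum.
      under eq_bigr => h do [rewrite inE => /andP[hE _]; rewrite expect_inside E_unif //].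
      rewrite sumr_const exprS -mulrnAr -[_ ^+ _ *+ _]mulr_natl ler_wpM2l //.
      exact: codegree1.
    rewrite sumr_const -[_ * _ *+ _]mulr_natl le_eqVlt; apply/orP; left; apply/eqP.
    by rewrite !mulrA; congr (_ / _); rewrite mulrC !mulrA.
  have le2 : \sum_(v in X0) Ex (closings L v [::]) <= #|X0|%:R * p / 4.
    apply: le_trans (_ : \sum_(v in X0) p / 4 <= _).
      apply: ler_sum => v _; apply: le_trans (expect_closings (hs := [::]) _ _) _ => //.
      rewrite cards1 expr1 ler_wpM2l //.
      have -> : beta * (1 + Q) ^+ L =
          ((K.+1 * L * D).+1 ^ L * 2 ^ (K.+1 * L))%:R * eta.
        rewrite natrM (natrX _ (K.+1 * L * D).+1) -natr1 [_%:R + 1]addrC -/Q /beta.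
        by rewrite [LHS]mulrC mulrA.
      by move: eta_small; rewrite -mulrA; set y := _ * eta; lra.
    by rewrite sumr_const -[_ / _ *+ _]mulr_natl mulrA.
  move: le1 le2; set x := #|X0|%:R * p; lra.
pose B1 := [set v in X0 | D.+1%:R <= dg v s].
pose B2 := [set v in X0 | 1 <= closings L v [::] s].
have dg_ge0 v : 0 <= dg v s by apply: sumr_ge0 => *; apply: inside_ge0.
have cB1 : #|B1|%:R <= D%:R^-1 * (\sum_(v in X0) dg v s).
  rewrite ler_pdivlMl ?ltr0n //.
  apply: le_trans (card_large_le X0 (ler0n F D.+1) dg_ge0).
  by rewrite ler_wpM2r ?ler0n // ler_nat.
have cB2 : #|B2|%:R <= \sum_(v in X0) closings L v [::] s.
  rewrite -[leLHS]mul1r; apply: card_large_le => // v; exact: closings_ge0.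
pose X := Rs s :\: (B1 :|: B2).
have sXR x : x \in X -> s x by rewrite !inE => /andP[_ /andP[]].
exists X; split.
- by apply/subsetP => v; rewrite !inE => /andP[_ /andP[]].
- apply: le_trans fs _; rewrite /f.
  have : #|Rs s|%:R <= #|X|%:R + (#|B1|%:R + #|B2|%:R) :> F.
    rewrite -!natrD ler_nat -(cardsID (B1 :|: B2) (Rs s)) addnC leq_add2l.
    apply: leq_trans (subset_leq_card (subsetIr _ _)) _.
    by rewrite leq_card_setU.
  by move: cB1 cB2; lra.
- move=> v; rewrite leqNgt; apply/negP => Dlt.
  have [h hv] : exists h, h \in edges_at [set h in E | h \subset X] v.
    by apply/card_gt0P; apply: leq_ltn_trans Dlt.
  have vX : v \in X.
    by move: hv; rewrite !inE => /andP[/andP[_ /subsetP hX] /hX]; rewrite !inE.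
  have := vX; rewrite !inE negb_or => /andP[/andP[+ _] /andP[vX0 _]].
  rewrite vX0 /= => /negP; apply.
  apply: le_trans (_ : #|edges_at [set h in E | h \subset X] v|%:R <= _); first by rewrite ler_nat.
  rewrite /dg [leRHS](bigID (fun h : {set V} => h \subset X)) /= -[leLHS]addr0 lerD //;
    last by apply: sumr_ge0 => *; apply: inside_ge0.
  rewrite -sum1_card natr_sum le_eqVlt; apply/orP; left; apply/eqP.
  apply: eq_big => [a|a]; rewrite !inE ?sub1set; first by rewrite andbAC.
  case/andP=> /andP[_ /subsetP aX] _; rewrite /inside.
  by case: forallP => // -[] x; apply/implyP => /aX /sXR.
- move=> v hs h sz; apply/negP => /and3P[t hE hc].
  (* For empty [hs] the span is just the root, which need not lie in [X]; this case is ruled out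
     below, since a closing hyperedge meets the span twice. *)
  have tE : hypertree E v hs /\ forall x, x \in span v hs -> (hs != [::]) -> x \in X.
    elim: (hs) t => [|a l IH] //= /and3P[].
    rewrite inE => /andP[aE /subsetP aX] a1 tl; have [tlE spl] := IH tl.
    split=> [|x]; first by rewrite aE a1.
    case/setUP=> [/aX //|xl] _; case: l IH tl tlE spl xl a1 => [|b l] IH tl tlE spl xl a1.
      rewrite inE in xl; rewrite (eqP xl); case/cards1P: a1 => y ey.
      have /setIP[ya /set1P <-] : y \in a :&: [set v] by rewrite ey set11.
      exact: aX.
    by apply: spl.
  have [tE1 spX] := tE.
  move: hE; rewrite inE => /andP[hE /subsetP hX].
  have hsn : hs != [::].
    apply: contraTneq hc => ->; rewrite negb_and -leqNgt.
    by rewrite (leq_trans (subset_leq_card (subsetIr _ _))) ?cards1.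
  have vX : v \in X by apply: spX; rewrite ?mem_span_root.
  have := vX; rewrite !inE negb_or => /andP[/andP[_ +] /andP[vX0 _]].
  rewrite vX0 /= => /negP; apply.
  apply: (@closings_ge1 L v hs [::] h); rewrite ?cats0 //; first exact: ltnW.
  by move=> x /setUP[/hX /sXR //|/spX /(_ hsn) /sXR].
Qed.

End Sparsify.

(** The greedy process runs on the hyperedges inside the sparse set [X]; a hyperedge contained in I
    would be one of them. The condition on [L] makes branches of depth up to [M] disjoint, and
    [accepted_mass] supplies z / 2. *)
Lemma independent_set (F : realFieldType) (V : finType) (E : {set {set V}})
    (X0 : {set V}) (K D M L : nat) (p eta z : F) :
  (forall h, h \in E -> #|h| = K.+1) ->
  (1 < K)%N -> (0 < D)%N -> (0 < M)%N -> ((M + M).+2 < L)%N ->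
  0 <= p <= 1 -> 0 <= eta ->
  (forall v, (codegree E [set v])%:R * p ^+ K <= D%:R / 4) ->
  (forall J : {set V}, (1 < #|J| <= K)%N ->
    (codegree E J)%:R * p ^+ (K.+1 - #|J|) <= eta) ->
  4 * ((K.+1 * L * D).+1 ^ L * 2 ^ (K.+1 * L))%:R * eta <= 1 ->
  0 <= z -> z ^+ K <= 2^-1 -> z <= (1 - z ^+ K) ^+ D ->
  (D * K.+1 ^ 2)%:R / M%:R <= z / 2 ->
  exists I : {set V}, [/\ I \subset X0, forall h, h \in E -> ~~ (h \subset I) &
    #|X0|%:R * p / 2 * (z / 2 - (D * K.+1 ^ 2)%:R / M%:R) <= #|I|%:R].
Proof.
move=> Eu K1 D0 M0 ML /andP[p0 p1] e0 c1 cJ es z0 z1 z2 z3.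
have L0 : (0 < L)%N by apply: leq_trans ML.
have L1 : (1 < L)%N by apply: leq_trans ML.
have [X [XX0 cX degX treeX]] := sparsify X0 Eu D0 L0 p0 p1 e0 c1 cJ es.
set E' := [set h in E | h \subset X] in degX treeX.
have Eu' h : h \in E' -> #|h| = K.+1 by rewrite inE => /andP[/Eu].
have rf d v b u : (d <= M)%N -> b \in E' -> v \in b -> u \in b -> u != v ->
    v \notin branch E' d b u.
  move=> dM; apply: (root_notin_branch Eu' K1 L1 treeX).
  by move: dM ML; clear; lia.
have bf d v b b' u u' : (d <= M)%N -> b \in E' -> b' \in E' -> v \in b -> v \in b' ->
    u \in b -> u' \in b' -> u != v -> u' != v -> (b, u) != (b', u') ->
    [disjoint branch E' d b u & branch E' d b' u'].
  move=> dM; apply: (branches_disjoint Eu' K1 L1 treeX).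
  by move: dM ML; clear; lia.
have EX' h : h \in E' -> h \subset X by rewrite inE => /andP[].
have [I [IX indI cI]] := greedy_independent F Eu' degX M0 rf bf EX'.
exists I; split.
- exact: subset_trans IX XX0.
- move=> h hE; apply/negP => hI; have := indI h; rewrite inE hE hI.
  by rewrite (subset_trans hI IX) => /(_ isT).
apply: le_trans cI; apply: le_trans (_ : #|X|%:R * (z / 2 - (D * K.+1 ^ 2)%:R / M%:R) <= _).
  by rewrite ler_wpM2r // subr_ge0.
rewrite ler_wpM2l ?ler0n // lerD2r; exact: accepted_mass.
Qed.

Local Close Scope ring_scope.

(** * The hypergraph of bicliques *)

Lemma bin_le_expn n j : 'C(n, j) <= n ^ j.
Proof.
have ff m : n ^_ m <= n ^ m.
  elim: m => // m IH; rewrite ffactnSr expnSr leq_mul //; exact: leq_subr.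
apply: leq_trans (ff j); rewrite -bin_ffact leq_pmulr //; exact: fact_gt0.
Qed.

(* Here a = u + 1, b = u + w + 1 and r = s + 1 with s = u + w + y.  At j = a b the
   two sides differ by u y + (u + w) (w + y), which vanishes only if a = b = 1 or
   a = b = r. *)
Lemma overlap_exponent_aux u w y j : j <= u.+1 * (u + w).+1 -> 1 < j ->
  j < (u + w + y).+1 * (u + w + y).+1 ->
  (u + w + y).+2 * (w + y + y) < 2 * ((u + w + y).+1 * (u + w + y).+1 - j).
Proof.
set s := u + w + y => jab j1 js.
have id : 2 * (s.+1 * s.+1) =
    s.+2 * (w + y + y) + 2 * (u.+1 * (u + w).+1) + (u * y + (u + w) * (w + y)).
  by rewrite /s; lia.
have [z|pos] := posnP (u * y + (u + w) * (w + y)); last by move: id jab js pos; clear; lia.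
move/eqP: z; rewrite addn_eq0 !muln_eq0 !addn_eq0.
case/andP=> /orP[/eqP u0|/eqP y0] /orP[/andP[/eqP u0' /eqP w0]|/andP[/eqP w0 /eqP y0']];
  by subst; rewrite /s in js *; lia.
Qed.

(** With p = theta q^2 and q = n^(-1/(r+1)), this says that n^(2r-a-b) p^(r^2-j) carries a positive
    power of [q]. The exponents being integers, a full factor [q] is gained: overlapping copies are
    rare. *)
Lemma overlap_exponent r a b j : 0 < a <= r -> 0 < b <= r -> j <= a * b ->
  1 < j < r ^ 2 -> r.+1 * (2 * r - (a + b)) < 2 * (r ^ 2 - j).
Proof.
wlog ab : a b / a <= b => [H|].
  case: (leqP a b) => [|/ltnW] ab ha hb jab; first exact: H.
  by rewrite addnC; apply: H => //; rewrite mulnC.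
rewrite -mulnn => /andP[a0 ar] /andP[b0 br] jab /andP[j1 jr].
have := @overlap_exponent_aux a.-1 (b - a) (r - b) j.
have -> : a.-1 + (b - a) + (r - b) = r.-1 by lia.
have -> : (a.-1 + (b - a)).+1 = b by lia.
have -> : b - a + (r - b) + (r - b) = 2 * r - (a + b) by lia.
rewrite !prednK //; last by lia.
by apply.
Qed.

Section BicliqueHypergraph.
Variables (n r : nat).
Implicit Types (A B : {set 'I_n}) (J : {set 'I_n * 'I_n}).

Definition upper_pairs : {set 'I_n * 'I_n} := [set e : 'I_n * 'I_n | e.1 < e.2].

Definition orient (e : 'I_n * 'I_n) := if e.1 < e.2 then e else (e.2, e.1).

Definition biclique A B : {set 'I_n * 'I_n} := orient @: setX A B.

Definition biclique_pairs : {set {set 'I_n} * {set 'I_n}} :=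
  [set X : {set 'I_n} * {set 'I_n} | [&& #|X.1| == r, #|X.2| == r & [disjoint X.1 & X.2]]].

Definition bicliques : {set {set 'I_n * 'I_n}} :=
  [set biclique X.1 X.2 | X in biclique_pairs].

Definition ends J : {set 'I_n} := (fst @: J) :|: (snd @: J).

Lemma card_upper_pairs : n * n <= 2 * #|upper_pairs| + n.
Proof.
have sub : [set: 'I_n * 'I_n] \subset upper_pairs :|:
    (fun e : 'I_n * 'I_n => (e.2, e.1)) @: upper_pairs :|: (fun i => (i, i)) @: [set: 'I_n].
  apply/subsetP => -[i j] _; rewrite !inE /=.
  case: (ltngtP i j) => [//|ji|/val_inj ->].
    by apply/orP; left; apply/imsetP; exists (j, i) => //; rewrite inE.
  by apply/orP; right; apply/imsetP; exists j; rewrite ?inE.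
have := subset_leq_card sub; rewrite cardsT card_prod card_ord => /leq_trans; apply.
apply: leq_trans (leq_card_setU _ _) _.
apply: leq_add; last by apply: leq_trans (leq_imset_card _ _) _; rewrite cardsT card_ord.
apply: leq_trans (leq_card_setU _ _) _; rewrite mul2n -addnn leq_add2l.
exact: leq_imset_card.
Qed.

Lemma orient_inj A B : [disjoint A & B] -> {in setX A B &, injective orient}.
Proof.
move=> dAB [a b] [a' b'] /setXP[/= aA bB] /setXP[/= a'A b'B].
rewrite /orient /=; case: ifP => _; case: ifP => _ // [] e1 e2; subst => //.
all: try by have := disjointFr dAB aA; rewrite ?bB ?b'B.
all: by have := disjointFr dAB a'A; rewrite ?bB ?b'B.
Qed.

Lemma card_biclique h : h \in bicliques -> #|h| = r ^ 2.
Proof.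
case/imsetP=> -[A B]; rewrite inE /= => /and3P[/eqP cA /eqP cB dAB] ->.
by rewrite card_in_imset ?cardsX ?cA ?cB // ; apply: orient_inj.
Qed.

Lemma ex_Krr_ge (D : {set 'I_n * 'I_n}) : D \subset upper_pairs ->
  (forall h, h \in bicliques -> ~~ (h \subset D)) -> #|D| <= ex_Krr n r.
Proof.
move=> /subsetP Dup ind; rewrite /ex_Krr.
apply: (leq_bigmax_cond (F := fun D' : {set 'I_n * 'I_n} => #|D'|)).
apply/andP; split.
  by apply/forallP => e; apply/implyP => /Dup; rewrite inE.
apply/existsP => -[A /existsP[B /and4P[cA cB dAB /forallP adjAB]]].
have hb : biclique A B \in bicliques.
  by apply/imsetP; exists (A, B); rewrite ?inE /= ?cA ?cB.
case/negP: (ind _ hb); apply/subsetP => _ /imsetP[[a b] /setXP[/= aA bB] ->].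
have := adjAB a; rewrite aA => /forallP/(_ b); rewrite bB /= /adj /orient /=.
case/orP=> eD; have := Dup _ eD; rewrite inE /= => lt; first by rewrite lt.
by rewrite ltnNge ltnW.
Qed.

Lemma biclique_ends J A B : [disjoint A & B] -> J \subset biclique A B ->
  [/\ ends J \subset A :|: B,
      #|J| <= #|A :&: ends J| * #|B :&: ends J| &
      #|A :&: ends J| + #|B :&: ends J| = #|ends J|].
Proof.
move=> dAB /subsetP JAB.
have sub : ends J \subset A :|: B.
  apply/subsetP => x /setUP[] /imsetP[e /JAB /imsetP[[a b] /setXP[/= aA bB] ->] ->];
  by rewrite /orient /=; case: ifP; rewrite inE ?aA ?bB ?orbT.
split=> //.
  rewrite -cardsX; apply: leq_trans (leq_imset_card orient _).
  apply: subset_leq_card; apply/subsetP => e eJ.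
  have /imsetP[[a b] /setXP[/= aA bB] ee] := JAB _ eJ.
  have e1 : e.1 \in ends J by apply/setUP; left; apply/imsetP; exists e.
  have e2 : e.2 \in ends J by apply/setUP; right; apply/imsetP; exists e.
  apply/imsetP; exists (a, b) => //; apply/setXP.
  by split; rewrite in_setI ?aA ?bB /=; move: e1 e2; rewrite ee /orient /=; case: ifP.
have := cardsUI (A :&: ends J) (B :&: ends J).
rewrite -setIUl (setIidPr sub) setIACA (disjoint_setI0 dAB) set0I cards0.
by rewrite addn0.
Qed.

Lemma codegree_pairs J : codegree bicliques J <=
  #|[set X in biclique_pairs | J \subset biclique X.1 X.2]|.
Proof.
apply: leq_trans (leq_imset_card (fun X : {set 'I_n} * {set 'I_n} => biclique X.1 X.2) _).
apply: subset_leq_card; apply/subsetP => h; rewrite inE => /andP[/imsetP[X Xp ->] JX].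
by apply/imsetP; exists X => //; rewrite inE Xp.
Qed.

(** A pair (A, B) is determined by the vertices of A and B outside [ends J], at most n^(2r-|ends J|)
    choices, and by A as a subset of the 2r vertices of the union, at most 4^r choices. *)
Lemma codegree_ends J :
  codegree bicliques J <= 4 ^ r * n ^ (2 * r - #|ends J|).
Proof.
apply: leq_trans (codegree_pairs J) _; set W := ends J.
pose phi (X : {set 'I_n} * {set 'I_n}) := ((X.1 :|: X.2) :\: W, X.1).
set S := [set X in _ | _].
have inS A B : (A, B) \in S -> [/\ #|A| = r, #|B| = r, [disjoint A & B]
    & W \subset A :|: B].
  rewrite !inE /= => /andP[/and3P[/eqP cA /eqP cB dAB] JAB]; split=> //.
  by have [] := biclique_ends dAB JAB.
have [->|/set0Pn[[A0 B0] /inS[cA0 cB0 _ sW]]] := eqVneq S set0.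
  by rewrite cards0.
have cW : #|W| <= 2 * r.
  apply: leq_trans (subset_leq_card sW) _; apply: leq_trans (leq_card_setU _ _) _.
  by rewrite cA0 cB0 addnn mul2n.
have phi_inj : {in S &, injective phi}.
  move=> [A B] [A' B'] /inS[_ _ d s] /inS[_ _ d' s'] [/= eS eA].
  rewrite -eA; congr pair; rewrite -eA in d' s' eS.
  have eU : A :|: B = A :|: B'.
    by rewrite -(setID (A :|: B) W) eS (setIidPr s) -{1}(setIidPr s') setID.
  have diff (C : {set 'I_n}) : [disjoint A & C] -> (A :|: C) :\: A = C.
    by move=> dC; rewrite setDUl setDv set0U; apply/setDidPl; rewrite disjoint_sym.
  by rewrite -(diff B d) eU diff.
rewrite -(card_in_imset phi_inj).
apply: leq_trans (_ : #|[set Y : {set 'I_n} * {set 'I_n} |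
    (#|Y.1| == 2 * r - #|W|) && (Y.2 \subset W :|: Y.1)]| <= _).
  apply: subset_leq_card; apply/subsetP => _ /imsetP[[A B] /inS[cA cB d s] ->].
  rewrite inE /= cardsD (setIidPr s) cardsU (disjoint_setI0 d) cards0 subn0.
  rewrite cA cB mul2n addnn eqxx /=.
  by apply/subsetP => x xA; rewrite in_setU in_setD in_setU xA; case: (x \in W).
rewrite -sum1_card.
under eq_bigl do rewrite inE.
rewrite -(pair_big_dep (fun T : {set 'I_n} => #|T| == 2 * r - #|W|)
  (fun T A : {set 'I_n} => A \subset W :|: T) (fun _ _ => 1)) /=.
apply: leq_trans (_ : \sum_(T : {set 'I_n} | #|T| == 2 * r - #|W|) 4 ^ r <= _).
  apply: leq_sum => T /eqP cT; rewrite sum1dep_card -/(powerset _) card_powerset.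
  rewrite (_ : 4 = 2 ^ 2) // -expnM leq_pexp2l //.
  by apply: leq_trans (leq_card_setU _ _) _; rewrite cT subnKC.
rewrite sum_nat_cond_const mulnC leq_mul2l; apply/orP; right.
by rewrite card_draws card_ord bin_le_expn.
Qed.

End BicliqueHypergraph.

(** Any biclique containing [J] can supply [a] and [b], the sizes of the traces of [ends J] on its
    sides, because the count depends only on their sum. *)
Lemma codegree_bicliques n r (J : {set 'I_n * 'I_n}) : J != set0 ->
  codegree (bicliques n r) J = 0 \/
  exists a b, [/\ 0 < a <= r, 0 < b <= r, #|J| <= a * b &
    codegree (bicliques n r) J <= 4 ^ r * n ^ (2 * r - (a + b))].
Proof.
rewrite -card_gt0 => J0; have [|c0] := posnP (codegree (bicliques n r) J); first by left.
right; have := leq_trans c0 (codegree_pairs _ J) => /card_gt0P[[A B]].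
rewrite !inE /= => /andP[/and3P[/eqP cA /eqP cB dAB] JAB].
have [_ cJ cE] := biclique_ends dAB JAB.
exists #|A :&: ends J|, #|B :&: ends J|; split=> //.
- apply/andP; split; last by rewrite -cA subset_leq_card ?subsetIl.
  by have := leq_trans J0 cJ; rewrite muln_gt0 => /andP[].
- apply/andP; split; last by rewrite -cB subset_leq_card ?subsetIl.
  by have := leq_trans J0 cJ; rewrite muln_gt0 => /andP[].
by rewrite cE codegree_ends.
Qed.


(** * The lower bound for bicliques over an ordered field *)

Local Open Scope ring_scope.

(** Instance of [independent_set] with p = theta q^2, M = D^3 and eta = D q. Roots enter only
    through their equations: q stands for n^(-1/(r+1)), and theta is set so that 4^r n^(2r-2) p^K =
    D / 4. *)
Lemma ex_Krr_lower (F : realFieldType) (n r D : nat) (q theta z : F) :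
  let K := (r ^ 2).-1 in let L := (D ^ 3 + D ^ 3).+3 in
  (1 < r)%N -> (0 < n)%N -> (0 < D)%N ->
  0 <= q -> q ^+ r.+1 * n%:R = 1 ->
  1 <= theta -> theta ^+ K * (4 * 4 ^+ r) = D%:R ->
  4 * ((r ^ 2 * L * D).+1 ^ L * 2 ^ (r ^ 2 * L))%:R * (D%:R * q) <= 1 ->
  0 <= z -> z ^+ K <= 2^-1 -> z <= (1 - z ^+ K) ^+ D ->
  4 * (r ^ 2)%:R ^+ 2 <= z * D%:R ^+ 2 ->
  #|upper_pairs n|%:R * (theta * q ^+ 2) / 2 * (z / 4) <= (ex_Krr n r)%:R.
Proof.
move=> K L r1 n0 D0 q0 qn th1 thK small z0 zh zD zbig.
have k1 : (3 < r ^ 2)%N by apply: leq_trans (_ : 2 ^ 2 <= _)%N => //; rewrite leq_exp2r.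
have kK : K.+1 = (r ^ 2)%N by rewrite prednK // (leq_trans _ k1).
have K1 : (1 < K)%N by rewrite -ltnS kK ltnW.
have D1 : 1 <= D%:R :> F by rewrite ler1n.
have Dq : D%:R * q <= 1.
  have N1 : 1 <= ((r ^ 2 * L * D).+1 ^ L * 2 ^ (r ^ 2 * L))%:R :> F.
    by rewrite ler1n muln_gt0 !expn_gt0.
  have Dq0 : 0 <= D%:R * q by rewrite mulr_ge0 ?ler0n.
  move: small N1 Dq0; set N := _%:R; set x := D%:R * q; clear; nra.
have q1 : q <= 1 by apply: le_trans Dq; rewrite ler_peMl.
have th0 : 0 <= theta by apply: le_trans th1.
have four : 1 <= 4 ^+ r :> F by rewrite exprn_ege1 // ler1n.
have thKD : 4 ^+ r * theta ^+ K = D%:R / 4 by rewrite -thK; clear; lra.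
have thD : theta <= D%:R.
  have e1 : theta <= theta ^+ K by rewrite ler_eXnr // ltnW.
  have e2 : theta ^+ K <= D%:R.
    rewrite -thK ler_peMr ?exprn_ge0 //; move: four; clear; lra.
  exact: le_trans e1 e2.
pose p := theta * q ^+ 2.
have p01 : 0 <= p <= 1.
  rewrite mulr_ge0 ?exprn_ge0 //= /p expr2 mulrA mulr_ile1 ?mulr_ge0 //.
  by apply: le_trans Dq; rewrite ler_wpM2r.
have nq e : n%:R ^+ e * q ^+ (r.+1 * e) = 1.
  by rewrite exprM -exprMn mulrC qn expr1n.
have cdeg (J : {set 'I_n * 'I_n}) e : (codegree (bicliques n r) J <= 4 ^ r * n ^ e)%N ->
    (codegree (bicliques n r) J)%:R <= 4 ^+ r * n%:R ^+ e :> F.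
  by move=> le; rewrite -!natrX -natrM ler_nat.
have c1 v : (codegree (bicliques n r) [set v])%:R * p ^+ K <= D%:R / 4.
  have D4 : 0 <= D%:R / 4 :> F by rewrite divr_ge0 ?ler0n.
  have v0 : [set v] != set0 by rewrite -card_gt0 cards1.
  have [->|[a [b [/andP[a0 ar] /andP[b0 br] _ c]]]] := codegree_bicliques r v0.
    by rewrite mul0r.
  have {}c : (codegree (bicliques n r) [set v] <= 4 ^ r * n ^ (2 * r - 2))%N.
    apply: leq_trans c _; rewrite leq_mul2l leq_pexp2l ?orbT //.
    by rewrite leq_sub2l // -[2%N]/(1 + 1)%N leq_add.
  apply: le_trans (_ : (4 ^+ r * n%:R ^+ (2 * r - 2)) * p ^+ K <= _).
    by rewrite ler_wpM2r ?cdeg // exprn_ge0 // (andP p01).1.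
  rewrite /p exprMn -exprM.
  (* This identity fixes the exponent in q^2: the powers of [n] and [q] cancel exactly. *)
  have -> : (2 * K = r.+1 * (2 * r - 2))%N.
    by rewrite /K -mulnn; move: r1; clear; nia.
  by rewrite mulrACA nq mulr1 thKD.
have cJ (J : {set 'I_n * 'I_n}) : (1 < #|J| <= K)%N ->
    (codegree (bicliques n r) J)%:R * p ^+ (K.+1 - #|J|) <= D%:R * q.
  move=> /andP[J1 JK].
  have Dq0 : 0 <= D%:R * q by rewrite mulr_ge0 ?ler0n.
  have J0 : J != set0 by rewrite -card_gt0 ltnW.
  have [->|[a [b [ha hb Jab c]]]] := codegree_bicliques r J0.
    by rewrite mul0r.
  have jr : (1 < #|J| < r ^ 2)%N by rewrite J1 -kK ltnS.
  have := overlap_exponent ha hb Jab jr.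
  set e := (2 * r - (a + b))%N in c *; set j := #|J| => exp.
  apply: le_trans (_ : (4 ^+ r * n%:R ^+ e) * p ^+ (K.+1 - j) <= _).
    by rewrite ler_wpM2r ?cdeg // exprn_ge0 // (andP p01).1.
  rewrite /p exprMn -exprM kK.
  (* The strict inequality of [overlap_exponent] leaves the spare factor [q]; as theta >= 1, its
     exponent may be raised to [K]. *)
  apply: le_trans (_ : (4 ^+ r * n%:R ^+ e) * (theta ^+ K * (q ^+ (r.+1 * e) * q)) <= _).
    rewrite ler_wpM2l ?mulr_ge0 ?exprn_ge0 ?ler0n //.
    apply: ler_pM; rewrite ?exprn_ge0 //.
      by rewrite ler_weXn2l // -kK; move: J1; rewrite -/j; clear; lia.
    by rewrite -exprSr ler_wiXn2l.
  rewrite mulrACA [n%:R ^+ e * _]mulrA nq mul1r thKD ler_wpM2r //.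
  by rewrite ler_piMr ?ler0n // invf_le1 ?ler1n ?ltr0n.
(* With M = D^3 the loss from ties is r^4 / D^2, which takes at most half of the gain z / 2. *)
have zM : (D * K.+1 ^ 2)%:R / (D ^ 3)%:R <= z / 4.
  have Dpos : 0 < D%:R :> F by rewrite ltr0n.
  rewrite kK natrM (natrX _ (r ^ 2)) (natrX _ D) ler_pdivrMr ?exprn_gt0 //.
  move: zbig; set x := (r ^ 2)%:R => zb.
  have -> : z / 4 * D%:R ^+ 3 = D%:R * (z * D%:R ^+ 2 / 4) by clear; lra.
  by rewrite ler_wpM2l ?ler0n //; move: zb; clear; lra.
have zM2 : (D * K.+1 ^ 2)%:R / (D ^ 3)%:R <= z / 2.
  by apply: le_trans zM _; move: z0; clear; lra.
have Eu h : h \in bicliques n r -> #|h| = K.+1 by rewrite kK; apply: card_biclique.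
have M0 : (0 < D ^ 3)%N by rewrite expn_gt0 D0.
have [I [IX ind cI]] := @independent_set F _ _ (upper_pairs n) _ _ _ L _ _ _ Eu K1 D0 M0
  (ltnSn _) p01 (mulr_ge0 (ler0n _ D) q0) c1 cJ (eq_ind_r (fun k => is_true
    (4 * ((k * L * D).+1 ^ L * 2 ^ (k * L))%:R * (D%:R * q) <= 1)) small kK) z0 zh zD zM2.
apply: le_trans (_ : #|I|%:R <= _); last by rewrite ler_nat ex_Krr_ge.
apply: le_trans cI; rewrite -/p ler_wpM2l ?divr_ge0 ?mulr_ge0 ?ler0n ?(andP p01).1 //.
by move: zM; clear; lra.
Qed.

Local Close Scope ring_scope.

(** By m + 1 <= 2^m the dominant exponent is k L D L, of order k D^7 since L has order D^3. This
    cost limits D to a small power of ln n. *)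
Lemma tree_depth_cost k D L : 0 < k -> 0 < D -> L = (D ^ 3 + D ^ 3).+3 ->
  4 * ((k * L * D).+1 ^ L * 2 ^ (k * L)) * D <= 2 ^ (40 * k * D ^ 7).
Proof.
move=> k0 D0 eL; have L0 : 0 < L by rewrite eL.
apply: leq_trans (_ : 2 ^ 2 * (2 ^ (k * L * D * L) * 2 ^ (k * L)) * 2 ^ D <= _).
  apply: leq_mul; last exact/ltnW/ltn_expl.
  rewrite leq_mul2l /= leq_mul2r; apply/orP; right.
  by rewrite expnM (leq_exp2r _ _ L0); apply: ltn_expl.
rewrite -!expnD leq_pexp2l //.
have pw i : D ^ i <= D ^ (i + (7 - i)) by rewrite expnD leq_pmulr // expn_gt0 D0.
have LD : L <= 5 * D ^ 3.
  have : 0 < D ^ 3 by rewrite expn_gt0 D0.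
  by rewrite eL; move: (D ^ 3) => t; clear; lia.
have d1 : 0 < D ^ 7 by rewrite expn_gt0 D0.
have d2 : D <= D ^ 7 by rewrite -{1}(expn1 D); apply: (pw 1%N).
have kL : k * L <= 5 * (k * D ^ 7).
  apply: leq_trans (_ : k * (5 * D ^ 3) <= _); first by rewrite leq_mul2l LD orbT.
  by rewrite mulnCA leq_mul2l /= leq_mul2l (pw 3) orbT.
have kLDL : k * L * D * L <= 25 * (k * D ^ 7).
  apply: leq_trans (_ : k * (5 * D ^ 3) * D * (5 * D ^ 3) <= _).
    by rewrite !leq_mul.
  have -> : D ^ 7 = D ^ 3 * D * D ^ 3 by rewrite -expnSr -expnD.
  by move: (D ^ 3) => t; apply: eq_leq; rewrite -!multE; ring.
have kD : D ^ 7 <= k * D ^ 7 by rewrite leq_pmull.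
rewrite -(mulnA 40 k); apply: leq_trans (_ : (2 + (25 + 5) + 1) * (k * D ^ 7) <= _); last first.
  by rewrite leq_mul2r orbT.
rewrite !mulnDl mul1n !leq_add ?(leq_trans d2) //.
by rewrite -{1}[2]muln1 leq_mul2l /= (leq_trans d1).
Qed.


(** * Transfer of the lower bound to the Stdlib reals *)

Local Open Scope R_scope.

Lemma ex_Krr_lower_R (n r D K m : nat) (q theta z : R) :
  (1 < r)%coq_nat -> (1 < n)%coq_nat -> (0 < D)%coq_nat ->
  S K = (r * r)%coq_nat ->
  m = (40 * (r * r) * (D * D * D * D * D * D * D))%coq_nat ->
  0 <= q -> q ^ S r * INR n = 1 ->
  1 <= theta -> theta ^ K * (4 * 4 ^ r) = INR D ->
  2 ^ m * q <= 1 ->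
  0 <= z -> z ^ K <= / 2 -> z <= (1 - z ^ K) ^ D ->
  4 * (INR r ^ 2) ^ 2 <= z * INR D ^ 2 ->
  INR n ^ 2 / 4 * (theta * q ^ 2) / 2 * (z / 4) <= INR (ex_Krr n r).
Proof.
move=> /ssrnat.ltP r1 /ssrnat.ltP n1 /ssrnat.ltP D0 eK em.
have n0 : (0 < n)%N by apply: ltnW.
have r0 : (0 < r)%N by apply: ltnW.
have {}eK : K = (r ^ 2)%N.-1 by rewrite -mulnn -multE -eK.
have {}em : m = (40 * r ^ 2 * D ^ 7)%N by rewrite em !multE -mulnn !expnS expn0 muln1 !mulnA.
have num i : IZR (Z.pos i) = (nat_of_pos i)%:R%R by rewrite IZRposE INRE.
move=> /RleP q0 qn /RleP th1 thK /RleP sm /RleP z0 /RleP zh /RleP zD /RleP zb.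
rewrite !num !RpowE ?INRE ?RmultE ?RinvE /= in qn thK sm zh zD zb.
apply/RleP; rewrite !RdivE !num !RpowE !INRE !RmultE /=.
have key := @ex_Krr_lower _ n r D q theta z r1 n0 D0 q0 qn th1.
rewrite -(natrX _ r) in zb; rewrite -eK in key; have {}key := key thK _ z0 zh zD zb.
have k0 : (0 < r ^ 2)%N by rewrite expn_gt0 r0.
have cost := tree_depth_cost k0 D0 (erefl _); rewrite -em in cost.
set L := (_.+3) in key cost.
apply: le_trans (key _).
  apply: ler_wpM2r; first by rewrite divr_ge0 ?ler0n.
  apply: ler_wpM2r; first by rewrite invr_ge0 ler0n.
  apply: ler_wpM2r; first by rewrite mulr_ge0 ?exprn_ge0 // (le_trans ler01 th1).
  rewrite ler_pdivrMr ?ltr0n // -natrX -natrM ler_nat -mulnn.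
  have := card_upper_pairs n; move: n1; move: #|_| => N; clear.
  move=> n1 h; have h2 : (n * 2 <= n * n)%N by rewrite leq_mul2l n1 orbT.
  by move: (n * n)%N h h2; clear; lia.
apply: le_trans sm; rewrite mulrA ler_wpM2r // -!natrM -natrX ler_nat.
exact: cost.
Qed.

End SparseHypergraphs.

(** * Choice of the parameters *)

From Stdlib Require Import Lra Lia.
Open Scope R_scope.

Lemma ln_le_sub1 x : 0 < x -> ln x <= x - 1.
Proof.
intros Hx. pose proof (exp_ineq1_le (ln x)) as H. rewrite exp_ln in H; lra.
Qed.

Lemma exp_monotone x y : x <= y -> exp x <= exp y.
Proof. intros [H| ->]; [left; now apply exp_increasing | right; reflexivity]. Qed.

Lemma ln_monotone x y : 0 < x -> x <= y -> ln x <= ln y.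
Proof. intros H0 [H| ->]; [left; now apply ln_increasing | right; reflexivity]. Qed.

Lemma Rpower_root_pow x K : 0 < x -> (0 < K)%nat -> Rpower x (/ INR K) ^ K = x.
Proof.
intros Hx HK. rewrite <- Rpower_pow by apply exp_pos.
rewrite Rpower_mult, Rinv_l by (apply not_0_INR; lia). now apply Rpower_1.
Qed.

Lemma exp_le_one_minus y : 0 <= y <= / 2 -> exp (- (2 * y)) <= 1 - y.
Proof.
intros [H0 H1]. rewrite exp_Ropp.
pose proof (exp_ineq1_le (2 * y)) as H.
apply Rle_trans with (/ (1 + 2 * y)).
- apply Rinv_le_contravar; lra.
- apply Rmult_le_reg_l with (1 + 2 * y); [lra|]. rewrite Rinv_r by lra. nra.
Qed.

Lemma exp_pow a n : exp a ^ n = exp (INR n * a).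
Proof.
induction n as [|n IH]; [simpl; now rewrite Rmult_0_l, exp_0|].
rewrite S_INR, Rmult_plus_distr_r, Rmult_1_l, exp_plus, <- IH. simpl. ring.
Qed.

(** Used with t = ln n. The cost exponent has order D^7, and the eighth factor D absorbs the
    constant 40 r^2 (r + 1). *)
Lemma eighth_root_floor t : 0 <= t -> exists D : nat, INR D ^ 8 <= t < INR (S D) ^ 8.
Proof.
intros Ht.
assert (H : forall N, t < INR N ^ 8 -> exists D : nat, INR D ^ 8 <= t < INR (S D) ^ 8).
{ induction N as [|N IH]; intros HN.
  - exfalso. simpl in HN. lra.
  - destruct (Rlt_le_dec t (INR N ^ 8)) as [H|H]; [now apply IH|]. now exists N. }
destruct (INR_unbounded t) as [N HN]. apply (H (S N)).
assert (1 <= INR (S N)) by (rewrite S_INR; pose proof (pos_INR N); lra).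
apply Rlt_le_trans with (INR (S N)); [rewrite S_INR; lra|].
rewrite <- (pow_1 (INR (S N))) at 1. apply Rle_pow; [lra | lia].
Qed.

(* Since y = ln D / (4 (K + 1) D), the right-hand side (1 - y) ^ D is at least
   D ^ (- 1 / (2 (K + 1))), while the K-th root of y is at most D ^ (- 1 / (2 K)). *)
Lemma threshold_density K D y : (2 <= K)%nat -> 1 <= ln (INR D) -> 0 < INR D ->
  y = ln (INR D) / (4 * (INR K + 1) * INR D) ->
  0 < y <= / 2 /\ Rpower y (/ INR K) <= (1 - y) ^ D /\ y <= Rpower y (/ INR K).
Proof.
intros HK Hln HD Hy.
assert (HKR : 2 <= INR K) by (apply (le_INR 2); exact HK).
pose proof (ln_le_sub1 _ HD) as Hl.
assert (Hy0 : 0 < y).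
{ rewrite Hy. apply Rdiv_lt_0_compat; [lra|]. nra. }
assert (Hmul : y * (4 * (INR K + 1) * INR D) = ln (INR D)).
{ rewrite Hy. field. lra. }
assert (Hy1 : y <= / 2).
{ apply Rmult_le_reg_r with (4 * (INR K + 1) * INR D); [nra|].
  rewrite Hmul. nra. }
split; [lra|]. split.
- apply Rle_trans with (exp (- (2 * y)) ^ D).
  2: { apply pow_incr. split; [left; apply exp_pos | apply exp_le_one_minus; lra]. }
  rewrite exp_pow. unfold Rpower. apply exp_monotone.
  (* Here y = t / D with t = ln D / (4 (K + 1)), and ln t <= t <= (ln D) / 2. *)
  assert (Hlny : ln y <= - (ln (INR D) / 2)).
  { assert (Hy' : y = (ln (INR D) / (4 * (INR K + 1))) * / INR D).
    { rewrite Hy. field. lra. }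
    rewrite Hy'. rewrite ln_mult, ln_Rinv; try lra.
    2: { apply Rdiv_lt_0_compat; [lra|]. lra. }
    2: { now apply Rinv_0_lt_compat. }
    assert (H1 : ln (ln (INR D) / (4 * (INR K + 1))) <= ln (INR D) / (4 * (INR K + 1))).
    { eapply Rle_trans; [apply ln_le_sub1|lra].
      apply Rdiv_lt_0_compat; [lra|]. lra. }
    assert (H2 : ln (INR D) / (4 * (INR K + 1)) <= ln (INR D) / 2).
    { apply Rmult_le_compat_l; [lra|]. apply Rinv_le_contravar; [lra|]. lra. }
    lra. }
  assert (H3 : INR D * (2 * y) = ln (INR D) / (2 * (INR K + 1))).
  { rewrite Hy. field. lra. }
  replace (INR D * - (2 * y)) with (- (ln (INR D) / (2 * (INR K + 1)))) by (rewrite <- H3; ring).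
  apply Rle_trans with (/ INR K * - (ln (INR D) / 2)).
  { apply Rmult_le_compat_l; [|exact Hlny]. left. apply Rinv_0_lt_compat. lra. }
  assert (H4 : / (INR K + 1) <= / INR K) by (apply Rinv_le_contravar; lra).
  replace (ln (INR D) / (2 * (INR K + 1))) with (ln (INR D) / 2 * / (INR K + 1))
    by (field; lra).
  nra.
- unfold Rpower. rewrite <- (exp_ln y) at 1 by exact Hy0. apply exp_monotone.
  assert (Hn : ln y <= 0) by (rewrite <- ln_1; apply ln_monotone; lra).
  assert (H5 : / INR K <= 1) by (rewrite <- Rinv_1; apply Rinv_le_contravar; lra).
  nra.
Qed.

(** Take K = r^2 - 1, y = ln D / (4 r^2 D), z = y^(1/K) and theta = (D / (4 4^r))^(1/K). In theta z
    the factor D cancels, leaving (ln D / (16 4^r r^2))^(1/K); ln ln n <= 16 ln D turns 16 into 256.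
    The 32 is 4 * 2 * 4 from [ex_Krr_lower_R]. *)
Lemma ex_Krr_quantitative (r n D : nat) : (5 <= r)%nat -> (2 <= n)%nat ->
  INR D ^ 8 <= ln (INR n) < INR (S D) ^ 8 ->
  40 * INR r ^ 2 * (INR r + 1) <= INR D -> 16 * (INR r ^ 2) ^ 3 <= INR D ->
  4 * 4 ^ r <= INR D -> 3 <= INR D ->
  Rpower (/ (256 * 4 ^ r * INR r ^ 2)) (1 / (INR r ^ 2 - 1)) / 32
    * Rpower (INR n) (2 - 2 / (INR r + 1))
    * Rpower (ln (ln (INR n))) (1 / (INR r ^ 2 - 1))
  <= INR (ex_Krr n r).
Proof.
intros Hr Hn [HD1 HD2] Hm Hk Hth H3.
assert (Hr5 : 5 <= INR r) by (apply (le_INR 5) in Hr; simpl in Hr; lra).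
assert (Hn2 : 2 <= INR n) by (apply (le_INR 2) in Hn; simpl in Hn; lra).
destruct (r * r)%nat as [|K] eqn:EK; [nia|].
assert (HK2 : (2 <= K)%nat) by nia.
assert (HkR : INR (S K) = INR r ^ 2) by (rewrite <- EK, mult_INR; ring).
assert (HKR : INR K = INR r ^ 2 - 1) by (rewrite <- HkR, S_INR; ring).
assert (Hlog1 : 1 <= ln (INR D)).
{ rewrite <- (ln_exp 1). apply ln_monotone; [apply exp_pos|]. pose proof exp_le_3. lra. }
assert (H4r : 0 < 4 ^ r) by (apply pow_lt; lra).
assert (HD : (0 < D)%nat) by (apply INR_lt; simpl; lra).
set (k := INR r ^ 2) in *. assert (Hk25 : 25 <= k) by (unfold k; nra).
set (x := INR D) in *.
destruct (threshold_density K D (ln x / (4 * (INR K + 1) * x)) HK2 Hlog1 ltac:(fold x; lra) eq_refl)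
  as [[Hy0 Hy1] [Hz1 Hz2]].
replace (INR K + 1) with k in Hy0, Hy1, Hz1, Hz2 by lra.
set (y := ln x / (4 * k * x)) in *.
set (z := Rpower y (/ INR K)) in *.
set (theta := Rpower (x / (4 * 4 ^ r)) (/ INR K)).
set (q := Rpower (INR n) (- / (INR r + 1))).
set (m := (40 * (r * r) * (D * D * D * D * D * D * D))%nat).
assert (HK0 : 0 < / INR K) by (apply Rinv_0_lt_compat; lra).
assert (HzK : z ^ K = y) by (apply Rpower_root_pow; [lra | lia]).
assert (Hx1 : 1 <= x / (4 * 4 ^ r)).
{ apply Rmult_le_reg_r with (4 * 4 ^ r); [lra|]. field_simplify; lra. }
assert (HthK : theta ^ K = x / (4 * 4 ^ r)) by (apply Rpower_root_pow; [lra | lia]).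
assert (Hth1 : 1 <= theta).
{ unfold theta, Rpower. rewrite <- exp_0 at 1. apply exp_monotone.
  apply Rmult_le_pos; [lra|]. rewrite <- ln_1. apply ln_monotone; lra. }
assert (Hq0 : 0 < q) by apply exp_pos.
assert (HqS : q ^ S r * INR n = 1).
{ rewrite <- (Rpower_pow (S r)) by exact Hq0. unfold q. rewrite Rpower_mult, S_INR.
  replace (- / (INR r + 1) * (INR r + 1)) with (Ropp 1) by (field; lra).
  rewrite Rpower_Ropp, Rpower_1 by lra. apply Rinv_l. lra. }
(* As 2 <= e, it suffices that m (r + 1) <= ln n; since m = 40 r^2 D^7, the left side is at most
   D^8. *)
assert (Hmq : 2 ^ m * q <= 1).
{ assert (H2m : 2 ^ m <= exp (INR m)).
  { rewrite <- (Rmult_1_r (INR m)), <- exp_pow. apply pow_incr.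
    pose proof (exp_ineq1_le 1). lra. }
  assert (Hm' : INR m = 40 * k * x ^ 7).
  { unfold m, k, x. rewrite !mult_INR.
    replace (INR 40) with 40 by (rewrite INR_IZR_INZ; reflexivity). ring. }
  assert (Hx7 : 0 < x ^ 7) by (apply pow_lt; lra).
  apply Rle_trans with (exp (INR m) * q); [apply Rmult_le_compat_r; lra|].
  unfold q, Rpower. rewrite <- exp_plus.
  apply Rle_trans with (exp 0); [apply exp_monotone | rewrite exp_0; lra].
  assert (INR m * (INR r + 1) <= ln (INR n)).
  { rewrite Hm'. apply Rle_trans with (x ^ 8); [|exact HD1].
    replace (40 * k * x ^ 7 * (INR r + 1)) with (40 * k * (INR r + 1) * x ^ 7) by ring.
    replace (x ^ 8) with (x * x ^ 7) by ring. apply Rmult_le_compat_r; lra. }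
  assert (INR m <= / (INR r + 1) * ln (INR n)); [|lra].
  apply Rmult_le_reg_r with (INR r + 1); [lra|].
  replace (/ (INR r + 1) * ln (INR n) * (INR r + 1)) with (ln (INR n)) by (field; lra).
  assumption. }
assert (Hzbig : 4 * k ^ 2 <= z * x ^ 2).
{ apply Rle_trans with (y * x ^ 2); [|apply Rmult_le_compat_r; [nra|exact Hz2]].
  replace (y * x ^ 2) with (ln x * (x / (4 * k))) by (unfold y; field; lra).
  assert (H4 : 4 * k ^ 2 <= x / (4 * k)).
  { apply Rmult_le_reg_r with (4 * k); [lra|].
    replace (x / (4 * k) * (4 * k)) with x by (field; lra).
    replace (4 * k ^ 2 * (4 * k)) with (16 * k ^ 3) by ring. exact Hk. }
  assert (0 <= 4 * k ^ 2) by nra. nra. }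
assert (HthD : theta ^ K * (4 * 4 ^ r) = INR D).
{ rewrite HthK. fold x. field. lra. }
assert (key := @SparseHypergraphs.ex_Krr_lower_R n r D K m q theta z
  ltac:(lia) ltac:(lia) HD (eq_sym EK) eq_refl ltac:(lra) HqS Hth1 HthD Hmq ltac:(lra)).
rewrite HzK in key. specialize (key Hy1 Hz1 Hzbig).
refine (Rle_trans _ _ _ _ key).
assert (Hnq : INR n ^ 2 * q ^ 2 = Rpower (INR n) (2 - 2 / (INR r + 1))).
{ rewrite <- (Rpower_pow 2 (INR n)), <- (Rpower_pow 2 q) by lra. unfold q.
  rewrite Rpower_mult, <- Rpower_plus. f_equal. simpl. field. lra. }
assert (Hll : 0 < ln (ln (INR n))).
{ rewrite <- ln_1. apply ln_increasing; [lra|].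
  apply Rlt_le_trans with (x ^ 8); [|exact HD1]. apply Rlt_pow_R1; [lra | lia]. }
(* From ln n < (D + 1)^8 <= (D^2)^8. *)
assert (Hlnx : ln (ln (INR n)) <= 16 * ln x).
{ replace 16 with (INR 16) by (rewrite INR_IZR_INZ; reflexivity).
  rewrite <- ln_pow by lra. apply ln_monotone.
  { apply Rlt_le_trans with (x ^ 8); [apply pow_lt; lra | exact HD1]. }
  left. apply Rlt_le_trans with (1 := HD2). rewrite S_INR. fold x.
  replace (x ^ 16) with ((x * x) ^ 8) by ring. apply pow_incr. nra. }
assert (Htz : Rpower (/ (256 * 4 ^ r * k)) (/ INR K) * Rpower (ln (ln (INR n))) (/ INR K)
              <= theta * z).
{ unfold theta, z. rewrite !Rpower_mult_distr; try lra.
  2: { apply Rinv_0_lt_compat. nra. }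
  apply Rle_Rpower_l; [lra|]. split.
  { apply Rmult_lt_0_compat; [apply Rinv_0_lt_compat; nra | lra]. }
  replace (x / (4 * 4 ^ r) * y) with (/ (256 * 4 ^ r * k) * (16 * ln x))
    by (unfold y; field; lra).
  apply Rmult_le_compat_l; [left; apply Rinv_0_lt_compat; nra | exact Hlnx]. }
replace (1 / (k - 1)) with (/ INR K) by (rewrite HKR; field; lra).
rewrite <- Hnq.
set (u := Rpower (/ _) _) in *. set (v := Rpower (ln _) _) in *.
replace (INR n ^ 2 / 4 * (theta * q ^ 2) / 2 * (z / 4))
  with (INR n ^ 2 * q ^ 2 / 32 * (theta * z)) by field.
replace (u / 32 * (INR n ^ 2 * q ^ 2) * v) with (INR n ^ 2 * q ^ 2 / 32 * (u * v)) by field.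
apply Rmult_le_compat_l; [|exact Htz].
assert (0 <= INR n ^ 2 * q ^ 2) by (apply Rmult_le_pos; apply pow2_ge_0). lra.
Qed.

Theorem theorem2 :
  forall r : nat, (5 <= r)%nat ->
  exists c : R, 0 < c /\
  exists N : nat, forall n : nat, (N <= n)%nat ->
    c * Rpower (INR n) (2 - 2 / (INR r + 1))
      * Rpower (ln (ln (INR n))) (1 / (INR r ^ 2 - 1))
    <= INR (ex_Krr n r).
Proof.
intros r Hr.
exists (Rpower (/ (256 * 4 ^ r * INR r ^ 2)) (1 / (INR r ^ 2 - 1)) / 32).
split; [apply Rdiv_lt_0_compat; [apply exp_pos | lra]|].
(* [B] exceeds every size required of D, and n >= exp (B^8) forces D >= B. *)
destruct (INR_unbounded (40 * INR r ^ 2 * (INR r + 1) + 16 * (INR r ^ 2) ^ 3 + 4 * 4 ^ r + 3))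
  as [B HB].
destruct (INR_unbounded (exp (INR B ^ 8))) as [N HN].
exists (N + 2)%nat. intros n Hn.
assert (HNn : INR N <= INR n) by (apply le_INR; lia).
assert (Hln : INR B ^ 8 <= ln (INR n)).
{ rewrite <- (ln_exp (INR B ^ 8)). apply ln_monotone; [apply exp_pos | lra]. }
assert (HB0 : 0 <= INR B ^ 8) by (apply pow_le, pos_INR).
destruct (eighth_root_floor (ln (INR n))) as [D [HD1 HD2]]; [lra|].
assert (HBD : INR B <= INR D).
{ apply le_INR. assert (B < S D)%nat; [|lia]. apply INR_lt.
  destruct (Rlt_le_dec (INR B) (INR (S D))) as [H|H]; [exact H|].
  assert (INR (S D) ^ 8 <= INR B ^ 8) by (apply pow_incr; split; [apply pos_INR | exact H]).
  lra. }
pose proof (pos_INR r) as Hr0.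
assert (0 <= 40 * INR r ^ 2 * (INR r + 1)) by (apply Rmult_le_pos; nra).
assert (0 <= (INR r ^ 2) ^ 3) by (apply pow_le, pow2_ge_0).
assert (0 < 4 ^ r) by (apply pow_lt; lra).
apply ex_Krr_quantitative with D; try lra; try lia.
Qed.
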